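(* Every MV-algebra $A$ can be embedded in the algebra of global sections of an MV-sheaf of Abelian $\ell$-groups; that is, for every MV-algebra $A$ there is a locally retractive MV-algebra $B$ such that $A$ embeds (as an MV-algebra) into the MV-algebra $\mathfrak B$ of global sections associated with $B$ as defined in the context.
   Context: **MV-algebra notation.** An MV-algebra is $(B,\oplus,{}^*,0)$; $x\odot y=(x^*\oplus y^* )^*$, $x\ominus y=x\odot y^*$. $\operatorname{Max}B$ is the set of maximal ideals, $\operatorname{Rad}B$ is the intersection of all maximal ideals, and for $M\in\operatorname{Max}B$, $O_M=\bigcap\{Q : Q \text{ minimal prime ideal of } B,\ Q\subseteq M\}$. One has $\operatorname{Rad}(B/O_M)=M/O_M$, so $(B/O_M)/\operatorname{Rad}(B/O_M)\cong B/M$. An MV-algebra $C$ has *retractive radical* if there is an embedding $j:C/\operatorname{Rad}C\to C$ with $p\circ j=\mathrm{id}$, where $p:C\to C/\operatorname{Rad}C$ is the natural projection. $B$ is *locally retractive* if $B/O_M$ has retractive radical for all $M\in\operatorname{Max}B$. **Fuzzy sets.** For each $M\in \operatorname{Max}B$ there is a unique embedding $\iota_M:B/M\to[0,1]$; for $b\in B$ let $\widehat b:\operatorname{Max}B\to[0,1]$, $\widehat b(M)=\iota_M(b/M)$ (also written $\frac bM$). An *MV-topology* on a set $X$ is a subset of $[0,1]^X$ containing the constants $\mathbf 0,\mathbf 1$ and closed under arbitrary joins and under binary $\odot,\oplus,\wedge$ (computed pointwise in the standard MV-algebra $[0,1]$). $\operatorname{Max}B$ carries the MV-topology $\tau_B$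 whose elements are all joins of sets of fuzzy sets $\widehat b$, $b\in B$. **Stalks.** Let $B$ be locally retractive. For every $M\in\operatorname{Max}B$ fix an embedding $B/M\to B/O_M$ that is right inverse to the natural projection $B/O_M\to B/M$, and identify $b/M$ with its image in $B/O_M$ whenever needed. Let $G(M/O_M)$ be the Abelian $\ell$-group of differences of the cancellative lattice-ordered monoid $(M/O_M,\oplus,0)$, and set $$g_{bM}=\Big(\tfrac{b}{O_M}\ominus\tfrac{b}{M}\Big)-\Big(\tfrac{b}{M}\ominus\tfrac{b}{O_M}\Big)\in G(M/O_M).$$ **The MV-sheaf and its sections.** Let $H_B=\{(g_{bM},M):b\in B,\ M\in\operatorname{Max}B\}$, $\pi:H_B\to\operatorname{Max}B$, $\pi(g_{bM},M)=M$, and $\widetilde b:\operatorname{Max}B\to H_B$, $\widetilde b(M)=(g_{bM},M)$. $H_B$ carries the MV-topology generated by the fuzzy sets $\widetilde b^{\to}(\widehat c)$ ($b,c\in B$), where $\widetilde b^{\to}(\widehat c)(y)=\bigvee_{\widetilde b(N)=y}\widehat c(N)$. $(H_B,\pi,\operatorname{Max}B)$ is the MV-sheaf space of Abelian $\ell$-groups associated with $B$. For $b\in B$ put $$\mathfrak b=\Big\{\Big(\tfrac bM,\,g_{bM}\Big)\Big\}_{M\in\operatorname{Max}B}$$ (a family indexed by $\operatorname{Max}B$). **The algebra $\mathfrak B$.** $\mathfrak B=\{\mathfrak b:b\in B\}$ with: $\mathfrak o$ the family associated with $0\in B$; for $\mathfrak b,\mathfrak c\in\mathfrak B$ associated with $b,c\in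 B$, $\mathfrak b\oplus\mathfrak c$ is the family associated with $b\oplus c$, and $\mathfrak b^*$ is the family associated with $b^*$. ''The algebra of global sections of an MV-sheaf of Abelian $\ell$-groups'' here refers to such a $\mathfrak B$. *)

(* Defs.v *)
From HB Require Import structures.
From mathcomp Require Import all_boot all_order all_algebra.
From mathcomp Require Import generic_quotient.
From mathcomp Require Import boolp classical_sets reals.
From mathcomp Require Import lra.

Set Implicit Arguments.
Unset Strict Implicit.
Unset Printing Implicit Defensive.

Import Order.TTheory GRing.Theory Num.Theory.

Local Open Scope classical_set_scope.
Local Open Scope quotient_scope.

Declare Scope mv_scope.
Delimit Scope mv_scope with MV.
Local Open Scope mv_scope.

HB.mixin Record isMVAlgebra T := {
  mvzero : T;
  mvadd : T -> T -> T;
  mvneg : T -> T;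
  mvaddA : associative mvadd;
  mvaddC : commutative mvadd;
  mvadd0x : left_id mvzero mvadd;
  mvnegK : involutive mvneg;
  mvadd1x : left_zero (mvneg mvzero) mvadd;
  mvjoin_sym : forall x y : T,
    mvadd (mvneg (mvadd (mvneg x) y)) y = mvadd (mvneg (mvadd (mvneg y) x)) x
}.

#[short(type="mvType")]
HB.structure Definition MVAlgebra := {T of isMVAlgebra T & Choice T}.

Notation "x ⊕ y" := (mvadd x y) (at level 50, left associativity) : mv_scope.
Notation "x ^*" := (mvneg x) : mv_scope.

Definition mvone {B : mvType} : B := (mvzero : B)^*.
Definition mvmul {B : mvType} (x y : B) : B := (x^* ⊕ y^*)^*.
Definition mvsub {B : mvType} (x y : B) : B := mvmul x y^*.
Notation "x ⊙ y" := (mvmul x y) (at level 40, left associativity) : mv_scope.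
Notation "x ⊖ y" := (mvsub x y) (at level 50, left associativity) : mv_scope.

Definition mvjoin {B : mvType} (x y : B) : B := (x ⊖ y) ⊕ y.
Definition mvmeet {B : mvType} (x y : B) : B := (mvjoin x^* y^*)^*.
Definition mvle {B : mvType} (x y : B) : bool := x ⊖ y == mvzero.

Definition mv_morphism (B C : mvType) (f : B -> C) : Prop :=
  [/\ f mvzero = mvzero,
      forall x y, f (x ⊕ y) = f x ⊕ f y
    & forall x, f x^* = (f x)^*].

Definition mv_embedding (B C : mvType) (f : B -> C) : Prop :=
  mv_morphism f /\ injective f.

Section Arithmetic.
Variable B : mvType.
Implicit Types x y z t : B.

Lemma mvaddx0 x : x ⊕ mvzero = x.
Proof. by rewrite mvaddC mvadd0x. Qed.

Lemma mvaddx1 x : x ⊕ mvone = mvone.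
Proof. by rewrite mvaddC /mvone mvadd1x. Qed.

Lemma mvaddxN x : x ⊕ x^* = mvone.
Proof.
have := mvjoin_sym x (mvone : B); rewrite !mvaddx1 {2}/mvone mvnegK mvadd0x => h.
by rewrite mvaddC -h.
Qed.

Lemma mvleE x y : mvle x y = (x^* ⊕ y == mvone).
Proof.
rewrite /mvle /mvsub /mvmul mvnegK /mvone.
by apply/eqP/eqP => [<-|->]; rewrite mvnegK.
Qed.

Lemma mvjoinC x y : mvjoin x y = mvjoin y x.
Proof. by rewrite /mvjoin /mvsub /mvmul !mvnegK mvjoin_sym. Qed.

Lemma mvle_add x z : mvle x (x ⊕ z).
Proof. by rewrite mvleE mvaddA (mvaddC x^*) mvaddxN /mvone mvadd1x eqxx. Qed.

Lemma mvle_addr x z : mvle x (z ⊕ x).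
Proof. by rewrite mvaddC mvle_add. Qed.

Lemma mvle_join x y : mvle x y -> mvjoin x y = y.
Proof. by move=> /eqP h; rewrite /mvjoin h mvadd0x. Qed.

Lemma mvle_ex x y : mvle x y -> exists z, y = x ⊕ z.
Proof.
by move=> /mvle_join; rewrite mvjoinC /mvjoin mvaddC => <-; exists (y ⊖ x).
Qed.

Lemma mvle_refl x : mvle x x.
Proof. by rewrite mvleE mvaddC mvaddxN eqxx. Qed.

Lemma mvle_trans y x z : mvle x y -> mvle y z -> mvle x z.
Proof. by move=> /mvle_ex[u ->] /mvle_ex[v ->]; rewrite -mvaddA mvle_add. Qed.

Lemma mvle_anti x y : mvle x y -> mvle y x -> x = y.
Proof. by move=> /mvle_join h1 /mvle_join h2; rewrite -h1 mvjoinC h2. Qed.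

Lemma mvle0 x : mvle x mvzero -> x = mvzero.
Proof. by rewrite mvleE mvaddx0 /mvone => /eqP h; rewrite -(mvnegK x) h mvnegK. Qed.

Lemma mvle_add2 x y z t : mvle x y -> mvle z t -> mvle (x ⊕ z) (y ⊕ t).
Proof.
move=> /mvle_ex[u ->] /mvle_ex[v ->].
by rewrite -mvaddA (mvaddA u) (mvaddC u) -(mvaddA z) mvaddA mvle_add.
Qed.

Lemma mvle_sub_add x y z : mvle (x ⊖ y) z = mvle x (y ⊕ z).
Proof. by rewrite !mvleE /mvsub /mvmul !mvnegK mvaddA. Qed.

Lemma mvle_addsub x y : mvle x (y ⊕ (x ⊖ y)).
Proof. by rewrite -mvle_sub_add mvle_refl. Qed.

Lemma mvle_subl x y : mvle (x ⊖ y) x.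
Proof. by rewrite mvle_sub_add mvle_addr. Qed.

Lemma mvle_sub2r x y z : mvle x y -> mvle (x ⊖ z) (y ⊖ z).
Proof. by move=> h; rewrite mvle_sub_add (mvle_trans h) // mvle_addsub. Qed.

Lemma mvsubxx x : x ⊖ x = mvzero.
Proof. exact/eqP/mvle_refl. Qed.

Lemma mvsubN x y : x^* ⊖ y^* = y ⊖ x.
Proof. by rewrite /mvsub /mvmul !mvnegK mvaddC. Qed.

Lemma mvsub_triangle y x z : mvle (x ⊖ z) ((x ⊖ y) ⊕ (y ⊖ z)).
Proof.
rewrite mvle_sub_add; apply: (mvle_trans (mvle_addsub x y)).
by rewrite mvaddA (mvaddC z) -mvaddA mvaddC mvle_add2 ?mvle_refl ?mvle_addsub.
Qed.

Lemma mvsub_add2 x y z t : mvle ((x ⊕ z) ⊖ (y ⊕ t)) ((x ⊖ y) ⊕ (z ⊖ t)).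
Proof.
rewrite mvle_sub_add -mvaddA (mvaddA t) (mvaddC t) -mvaddA mvaddA.
by rewrite mvle_add2 // mvle_addsub.
Qed.

Lemma mvjoin_lub x y z : mvle (mvjoin x y) z = mvle x z && mvle y z.
Proof.
apply/idP/andP=> [h|[hx hy]]; last first.
  rewrite -(mvle_join hy) (mvjoinC y) /mvjoin.
  by rewrite mvle_add2 ?mvle_refl // mvle_sub2r.
split; last by apply: mvle_trans h; rewrite /mvjoin mvle_addr.
by apply: mvle_trans h; rewrite mvjoinC /mvjoin mvle_addr.
Qed.

Lemma mvaddK x y : x ⊙ y = mvzero -> (x ⊕ y) ⊖ y = x.
Proof.
move=> h; rewrite /mvsub /mvmul mvnegK -{1}(mvnegK x) mvjoin_sym.
rewrite mvaddC (_ : (y^* ⊕ x^*)^* = mvzero) ?mvaddx0 ?mvnegK //.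
by rewrite mvaddC.
Qed.

End Arithmetic.

Definition is_ideal (B : mvType) (I : set B) : Prop :=
  [/\ I mvzero,
      forall x y, I x -> I y -> I (x ⊕ y)
    & forall x y, mvle x y -> I y -> I x].

Record mvideal (B : mvType) := MVIdeal {
  ideal_set :> B -> Prop;
  idealP : is_ideal ideal_set
}.

Section Quotient.
Variables (B : mvType) (I : mvideal B).

Lemma ideal0 : I mvzero. Proof. by case: (idealP I). Qed.
Lemma idealD x y : I x -> I y -> I (x ⊕ y).
Proof. by case: (idealP I) => _ + _; apply. Qed.
Lemma ideal_le x y : mvle x y -> I y -> I x.
Proof. by case: (idealP I) => _ _; apply. Qed.

Definition quo_rel : rel B := fun x y => `[< I ((x ⊖ y) ⊕ (y ⊖ x)) >].

Lemma quo_relP x y : quo_rel x y <-> I (x ⊖ y) /\ I (y ⊖ x).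
Proof.
split=> [/asboolP h|[h1 h2]]; last exact/asboolP/idealD.
by split; apply: ideal_le h; rewrite ?mvle_add ?mvle_addr.
Qed.

Fact quo_rel_refl : reflexive quo_rel.
Proof. by move=> x; apply/quo_relP; rewrite mvsubxx; split; apply: ideal0. Qed.
Fact quo_rel_sym : symmetric quo_rel.
Proof. by move=> x y; rewrite /quo_rel mvaddC. Qed.
Fact quo_rel_trans : transitive quo_rel.
Proof.
move=> y x z /quo_relP[h1 h2] /quo_relP[h3 h4]; apply/quo_relP; split.
  exact: ideal_le (mvsub_triangle y _ _) (idealD h1 h3).
exact: ideal_le (mvsub_triangle y _ _) (idealD h4 h2).
Qed.

Canonical quo_equiv :=
  EquivRel quo_rel quo_rel_refl quo_rel_sym quo_rel_trans.

Definition quo := {eq_quot quo_equiv}.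
HB.instance Definition _ := Choice.on quo.
HB.instance Definition _ := EqQuotient.on quo.

Definition cls (b : B) : quo := \pi_quo b.

Lemma clsP x y : cls x = cls y <-> I (x ⊖ y) /\ I (y ⊖ x).
Proof. by rewrite -quo_relP; split=> [/eqquotP|h]; [|apply/eqquotP]. Qed.

Lemma cls_repr x : cls (repr x) = x. Proof. exact: reprK. Qed.

Definition quo_add (x y : quo) : quo := cls (repr x ⊕ repr y).
Definition quo_neg (x : quo) : quo := cls (repr x)^*.

Lemma quo_addE x y : quo_add (cls x) (cls y) = cls (x ⊕ y).
Proof.
have /clsP[h1 h2] := cls_repr (cls x); have /clsP[h3 h4] := cls_repr (cls y).
apply/clsP; split.
  exact: ideal_le (mvsub_add2 _ _ _ _) (idealD h1 h3).
exact: ideal_le (mvsub_add2 _ _ _ _) (idealD h2 h4).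
Qed.

Lemma quo_negE x : quo_neg (cls x) = cls x^*.
Proof. by have /clsP[h1 h2] := cls_repr (cls x); apply/clsP; rewrite !mvsubN. Qed.

Fact quo_addA : associative quo_add.
Proof.
move=> x y z; rewrite -(cls_repr x) -(cls_repr y) -(cls_repr z).
by rewrite !quo_addE mvaddA.
Qed.
Fact quo_addC : commutative quo_add.
Proof. by move=> x y; rewrite /quo_add mvaddC. Qed.
Fact quo_add0 : left_id (cls mvzero) quo_add.
Proof. by move=> x; rewrite -(cls_repr x) quo_addE mvadd0x. Qed.
Fact quo_negK : involutive quo_neg.
Proof. by move=> x; rewrite -(cls_repr x) !quo_negE mvnegK. Qed.
Fact quo_add1 : left_zero (quo_neg (cls mvzero)) quo_add.
Proof. by move=> x; rewrite -(cls_repr x) quo_negE quo_addE mvadd1x. Qed.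
Fact quo_join_sym x y :
  quo_add (quo_neg (quo_add (quo_neg x) y)) y =
  quo_add (quo_neg (quo_add (quo_neg y) x)) x.
Proof.
rewrite -(cls_repr x) -(cls_repr y).
by rewrite !(quo_negE, quo_addE) mvjoin_sym.
Qed.

HB.instance Definition _ := isMVAlgebra.Build quo
  quo_addA quo_addC quo_add0 quo_negK quo_add1 quo_join_sym.

Lemma clsD x y : cls (x ⊕ y) = cls x ⊕ cls y.
Proof. by rewrite -quo_addE. Qed.
Lemma clsN x : cls x^* = (cls x)^*.
Proof. by rewrite -quo_negE. Qed.
Lemma clsM x y : cls (x ⊙ y) = cls x ⊙ cls y.
Proof. by rewrite /mvmul !(clsN, clsD). Qed.
Lemma clsB x y : cls (x ⊖ y) = cls x ⊖ cls y.
Proof. by rewrite /mvsub clsM clsN. Qed.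
Lemma cls0P x : cls x = mvzero <-> I x.
Proof.
rewrite (_ : mvzero = cls mvzero) //.
have e0 : x ⊖ mvzero = x.
  by rewrite /mvsub /mvmul mvnegK mvaddx0 mvnegK.
have e1 : mvzero ⊖ x = mvzero.
  by apply/eqP; have := mvle_add mvzero x; rewrite mvadd0x.
by rewrite clsP e0 e1; split=> [[]|] //; split=> //; apply: ideal0.
Qed.

End Quotient.

Arguments cls {B} I b.

Section Spectrum.
Variable B : mvType.

Definition maximal_ideal (M : set B) : Prop :=
  [/\ is_ideal M, M != setT
    & forall J : set B, is_ideal J -> J != setT -> M `<=` J -> J = M].

Definition prime_ideal (P : set B) : Prop :=
  [/\ is_ideal P, P != setT & forall x y, P (x ⊖ y) \/ P (y ⊖ x)].

Definition minimal_prime (Q : set B) : Prop :=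
  prime_ideal Q /\ forall P : set B, prime_ideal P -> P `<=` Q -> P = Q.

Record maxspec := MaxSpec {
  max_ideal :> mvideal B;
  max_idealP : maximal_ideal (ideal_set max_ideal)
}.

Lemma bigcap_ideal (F : set (set B)) :
  (forall I, F I -> is_ideal I) -> is_ideal (\bigcap_(I in F) I).
Proof.
move=> hF; split=> [I /hF[]//|x y hx hy I FI|x y hxy hy I FI].
  by have [_ + _] := hF _ FI; apply; [apply: hx|apply: hy].
by have [_ _] := hF _ FI; apply; [exact: hxy|exact: hy].
Qed.

Fact rad_subproof : is_ideal (\bigcap_(I in maximal_ideal) I).
Proof. by apply: bigcap_ideal => I []. Qed.
Definition Rad : mvideal B := MVIdeal rad_subproof.

Fact germ_subproof (M : maxspec) :
  is_ideal (\bigcap_(Q in [set Q | minimal_prime Q /\ Q `<=` ideal_set M]) Q).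
Proof. by apply: bigcap_ideal => Q [[[]]]. Qed.
(* O_M *)
Definition germ (M : maxspec) : mvideal B := MVIdeal (germ_subproof M).

Lemma max_not1 (M : maxspec) : ~ M mvone.
Proof.
have [_ /eqP nT _] := max_idealP M => h1; apply: nT.
apply/seteqP; split=> // x _; apply: ideal_le h1.
by rewrite mvleE mvaddx1.
Qed.

Lemma max_mul_germ (M : maxspec) x y : M x -> M y -> germ M (x ⊙ y).
Proof.
move=> Mx My Q [[[iQ _ pQ] _] QM].
have [|h] := pQ x y^*; first by rewrite /mvsub mvnegK.
case: (@max_not1 M); rewrite -(mvaddxN y).
apply: idealD => //; apply: ideal_le (mvle_addsub y^* x) _.
by apply: idealD => //; apply: QM.
Qed.

End Spectrum.

Definition retractive (C : mvType) : Prop :=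
  exists j : quo (Rad C) -> C,
    mv_embedding j /\ forall x, cls (Rad C) (j x) = x.

Definition locally_retractive (B : mvType) : Prop :=
  forall M : maxspec B, retractive (quo (germ M)).

Section UnitInterval.
Variable R : realType.
Local Open Scope ring_scope.

Definition I01 := {x : R | 0 <= x <= 1}.
HB.instance Definition _ := Choice.on I01.

Fact i01_zero_subproof : (0 : R) <= (0 : R) <= (1 : R). Proof. by lra. Qed.
Fact i01_add_subproof (x y : I01) : 0 <= Num.min 1 (val x + val y) <= 1.
Proof.
have /andP[x0 x1] := valP x; have /andP[y0 y1] := valP y.
by case: (leP 1 (val x + val y)) => h; apply/andP; split; lra.
Qed.
Fact i01_neg_subproof (x : I01) : 0 <= 1 - val x <= 1.
Proof. by have /andP[x0 x1] := valP x; apply/andP; split; lra. Qed.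

Definition i01_zero : I01 := exist _ 0 i01_zero_subproof.
Definition i01_add (x y : I01) : I01 :=
  exist _ (Num.min 1 (val x + val y)) (i01_add_subproof x y).
Definition i01_neg (x : I01) : I01 := exist _ (1 - val x) (i01_neg_subproof x).

Fact i01_addA : associative i01_add.
Proof.
move=> [x hx] [y hy] [z hz]; apply: val_inj => /=.
case/andP: hx hy hz => x0 x1 /andP[y0 y1] /andP[z0 z1].
case: (leP 1 (x + y)) => h1; case: (leP 1 (y + z)) => h2.
- by case: (leP 1 (x + 1)); case: (leP 1 (1 + z)); lra.
- by case: (leP 1 (x + (y + z))) => ?; case: (leP 1 (1 + z)); lra.
- by case: (leP 1 (x + 1)) => ?; case: (leP 1 (x + y + z)); lra.
- by rewrite addrA.
Qed.
Fact i01_addC : commutative i01_add.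
Proof. by move=> x y; apply: val_inj; rewrite /= addrC. Qed.
Fact i01_add0 : left_id i01_zero i01_add.
Proof.
move=> [x hx]; apply: val_inj => /=; case/andP: hx => x0 x1.
by case: (leP 1 (0 + x)) => ?; lra.
Qed.
Fact i01_negK : involutive i01_neg.
Proof. by move=> [x hx]; apply: val_inj => /=; lra. Qed.
Fact i01_add1 : left_zero (i01_neg i01_zero) i01_add.
Proof.
move=> [x hx]; apply: val_inj => /=; case/andP: hx => x0 x1.
by case: (leP 1 (1 - 0 + x)) => ?; lra.
Qed.
Fact i01_join_sym x y :
  i01_add (i01_neg (i01_add (i01_neg x) y)) y =
  i01_add (i01_neg (i01_add (i01_neg y) x)) x.
Proof.
move: x y => [x hx] [y hy]; apply: val_inj => /=.
case/andP: hx hy => x0 x1 /andP[y0 y1].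
case: (leP 1 (1 - x + y)) => h1; case: (leP 1 (1 - y + x)) => h2.
- by case: (leP 1 (1 - 1 + y)); case: (leP 1 (1 - 1 + x)); lra.
- by case: (leP 1 (1 - 1 + y)); case: (leP 1 (1 - (1 - y + x) + x)); lra.
- by case: (leP 1 (1 - 1 + x)); case: (leP 1 (1 - (1 - x + y) + y)); lra.
- by lra.
Qed.

HB.instance Definition _ := isMVAlgebra.Build I01
  i01_addA i01_addC i01_add0 i01_negK i01_add1 i01_join_sym.

Fact i01_sup_subproof (S : set I01) : 0 <= sup (val @` S) <= 1.
Proof.
have [->|/set0P[x Sx]] := eqVneq S set0.
  by rewrite image_set0 sup0 lexx ler01.
have ub : ubound (val @` S) 1.
  by move=> _ [y _ <-]; have /andP[] := valP y.
apply/andP; split; last by apply: sup_le_ub => //; exists (val x), x.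
have /andP[x0 _] := valP x; apply: le_trans x0 _.
apply: ub_le_sup; first by exists 1.
by exists x.
Qed.
(* [sup set0 = 0] in [R], as it should be in the complete lattice [0,1]. *)
Definition i01_sup (S : set I01) : I01 :=
  exist _ (sup (val @` S)) (i01_sup_subproof S).

Definition fuzzy (X : Type) := X -> I01.

Definition fuzzy_join (X : Type) (F : set (fuzzy X)) : fuzzy X :=
  fun x => i01_sup [set f x | f in F].

Definition mv_topology (X : Type) (T : set (fuzzy X)) : Prop :=
  [/\ T (fun=> mvzero) /\ T (fun=> mvone),
      forall F, F `<=` T -> T (fuzzy_join F)
    & forall f g, T f -> T g ->
        [/\ T (fun x => f x ⊙ g x), T (fun x => f x ⊕ g x)
          & T (fun x => mvmeet (f x) (g x))]].

Definition generated_mv_topology (X : Type) (S : set (fuzzy X)) :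
    set (fuzzy X) :=
  \bigcap_(T in [set T | mv_topology T /\ S `<=` T]) T.

(* f^-> *)
Definition fuzzy_image (X Y : Type) (f : X -> Y) (a : fuzzy X) : fuzzy Y :=
  fun y => i01_sup [set a x | x in [set x | f x = y]].

(* The embedding of B/M into [0,1] exists and is unique, as B/M is simple. *)
Definition point_embed (B : mvType) (M : maxspec B) : quo M -> I01 :=
  xget (fun=> i01_zero) [set f : quo M -> I01 | mv_embedding f].

Definition hat (B : mvType) (b : B) : fuzzy (maxspec B) :=
  fun M => point_embed (cls M b).

Definition max_topology (B : mvType) : set (fuzzy (maxspec B)) :=
  [set fuzzy_join F | F in [set F | F `<=` range (@hat B)]].

End UnitInterval.

Section Stalk.
Variables (B : mvType) (M : maxspec B).

Definition germ_image : set (quo (germ M)) := [set cls (germ M) b | b in ideal_set M].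
(* M/O_M as a monoid; by [infl_addI] below it is cancellative. *)
Definition infl := set_type germ_image.
HB.instance Definition _ := Choice.on infl.
HB.instance Definition _ := SubChoice.on infl.

Lemma germ_image_mul x y : germ_image x -> germ_image y -> x ⊙ y = mvzero.
Proof. by move=> [a Ma <-] [b Mb <-]; rewrite -clsM cls0P; apply: max_mul_germ. Qed.

Lemma germ_imageD x y : germ_image x -> germ_image y -> germ_image (x ⊕ y).
Proof.
move=> [a Ma <-] [b Mb <-]; rewrite -clsD; exists (a ⊕ b) => //.
exact: idealD.
Qed.

Lemma germ_image_le x y : mvle x y -> germ_image y -> germ_image x.
Proof.
move=> xy [b Mb eb]; exists (repr x ⊖ (repr x ⊖ b)); last first.
  rewrite !clsB cls_repr eb (eqP xy) /mvsub /mvmul mvnegK mvaddx0.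
  by rewrite mvnegK.
by apply: ideal_le Mb; rewrite mvle_sub_add mvaddC mvle_addsub.
Qed.

Lemma germ_image0 : germ_image mvzero.
Proof. by exists mvzero => //; apply: ideal0. Qed.

Definition infl_zero : infl := SigSub (mem_set germ_image0).
Definition infl_add (x y : infl) : infl :=
  SigSub (mem_set (germ_imageD (set_valP x) (set_valP y))).

Fact infl_addA : associative infl_add.
Proof. by move=> x y z; apply: val_inj; rewrite /= mvaddA. Qed.
Fact infl_addC : commutative infl_add.
Proof. by move=> x y; apply: val_inj; rewrite /= mvaddC. Qed.
Fact infl_add0 : left_id infl_zero infl_add.
Proof. by move=> x; apply: val_inj; rewrite /= mvadd0x. Qed.

HB.instance Definition _ := GRing.isNmodule.Build infl
  infl_addA infl_addC infl_add0.

Definition infl_le (x y : infl) : bool := mvle (val x) (val y).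

Lemma infl_le_trans (y x z : infl) : infl_le x y -> infl_le y z -> infl_le x z.
Proof. exact: mvle_trans. Qed.

Lemma val_inflD (x y : infl) : val (x + y)%R = val x ⊕ val y.
Proof. by []. Qed.

Lemma infl_addK (k x : infl) : (val x ⊕ val k) ⊖ val k = val x.
Proof. by apply: mvaddK; apply: germ_image_mul; apply: set_valP. Qed.

Lemma infl_addI (k x y : infl) : (x + k = y + k)%R -> x = y.
Proof.
move=> /(congr1 val) e; apply: val_inj.
by rewrite -(infl_addK k x) -val_inflD e val_inflD infl_addK.
Qed.

Lemma infl_leD2 (k x y : infl) : infl_le (x + k)%R (y + k)%R = infl_le x y.
Proof.
apply/idP/idP; rewrite /infl_le => h; last by rewrite mvle_add2 ?mvle_refl.
by rewrite -(infl_addK k x) -(infl_addK k y) mvle_sub2r.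
Qed.

Lemma infl_join_subproof (x y : infl) : germ_image (mvjoin (val x) (val y)).
Proof.
apply: (@germ_image_le _ (val x ⊕ val y)); last exact: set_valP (x + y)%R.
by rewrite mvjoin_lub mvle_add mvle_addr.
Qed.
Definition infl_join (x y : infl) : infl :=
  SigSub (mem_set (infl_join_subproof x y)).

Lemma infl_join_le (k x y z : infl) :
  infl_le (infl_join x y + k)%R z = infl_le (x + k)%R z && infl_le (y + k)%R z.
Proof.
have le_sub (u : infl) : infl_le (u + k)%R z ->
    mvle (val u) (val z ⊖ val k) /\ mvle (val k) (val z).
  move=> h; split; last exact: mvle_trans (mvle_addr _ _) h.
  by rewrite -(infl_addK k u) mvle_sub2r.
apply/idP/andP => [h|[/le_sub[hx kz] /le_sub[hy _]]].
  have := mvle_refl (mvjoin (val x) (val y)); rewrite mvjoin_lub => /andP[jx jy].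
  by split; apply: mvle_trans h; rewrite mvle_add2 ?mvle_refl.
have := mvle_join kz; rewrite mvjoinC /infl_le val_inflD => <-.
by rewrite mvle_add2 ?mvle_refl // mvjoin_lub hx.
Qed.

Definition diff_rel : rel (infl * infl) :=
  fun p q => (p.1 + q.2 == q.1 + p.2)%R.

Fact diff_rel_refl : reflexive diff_rel.
Proof. by move=> p; apply/eqP. Qed.
Fact diff_rel_sym : symmetric diff_rel.
Proof. by move=> p q; rewrite /diff_rel eq_sym. Qed.
Fact diff_rel_trans : transitive diff_rel.
Proof.
move=> q p r /eqP h1 /eqP h2; apply/eqP/(@infl_addI q.2).
by rewrite addrAC h1 addrAC h2 addrAC.
Qed.

Canonical diff_equiv :=
  EquivRel diff_rel diff_rel_refl diff_rel_sym diff_rel_trans.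

Definition diff_group := {eq_quot diff_equiv}.
HB.instance Definition _ := Choice.on diff_group.
HB.instance Definition _ := EqQuotient.on diff_group.

Definition mkdiff (a b : infl) : diff_group := \pi_diff_group (a, b).

Lemma diffP a b c d : mkdiff a b = mkdiff c d <-> (a + d = c + b)%R.
Proof. by split=> [/eqquotP/eqP|h] //; apply/eqquotP/eqP. Qed.

Lemma diff_repr x : mkdiff (repr x).1 (repr x).2 = x.
Proof. by rewrite /mkdiff -surjective_pairing reprK. Qed.

Definition diff_add (x y : diff_group) : diff_group :=
  mkdiff ((repr x).1 + (repr y).1)%R ((repr x).2 + (repr y).2)%R.
Definition diff_opp (x : diff_group) : diff_group := mkdiff (repr x).2 (repr x).1.

Lemma diff_addE a b c d : diff_add (mkdiff a b) (mkdiff c d) = mkdiff (a + c)%R (b + d)%R.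
Proof.
have /diffP h1 := diff_repr (mkdiff a b); have /diffP h2 := diff_repr (mkdiff c d).
by apply/diffP; rewrite addrACA h1 h2 addrACA.
Qed.

Lemma diff_oppE a b : diff_opp (mkdiff a b) = mkdiff b a.
Proof.
have /diffP h := diff_repr (mkdiff a b).
by apply/diffP; rewrite addrC -h addrC.
Qed.

Fact diff_addA : associative diff_add.
Proof.
move=> x y z; rewrite -(diff_repr x) -(diff_repr y) -(diff_repr z).
by rewrite !diff_addE !addrA.
Qed.
Fact diff_addC : commutative diff_add.
Proof.
move=> x y; rewrite -(diff_repr x) -(diff_repr y) !diff_addE.
by congr mkdiff; apply: addrC.
Qed.
Fact diff_add0 : left_id (mkdiff 0%R 0%R) diff_add.
Proof. by move=> x; rewrite -(diff_repr x) diff_addE !add0r. Qed.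
Fact diff_addN : left_inverse (mkdiff 0%R 0%R) diff_opp diff_add.
Proof.
move=> x; rewrite -(diff_repr x) diff_oppE diff_addE; apply/diffP.
by rewrite addr0 add0r addrC.
Qed.

HB.instance Definition _ := GRing.isZmodule.Build diff_group
  diff_addA diff_addC diff_add0 diff_addN.

Definition diff_le (x y : diff_group) : bool :=
  infl_le ((repr x).1 + (repr y).2)%R ((repr y).1 + (repr x).2)%R.

Lemma diff_leE a b c d : diff_le (mkdiff a b) (mkdiff c d) = infl_le (a + d)%R (c + b)%R.
Proof.
have /diffP h1 := diff_repr (mkdiff a b); have /diffP h2 := diff_repr (mkdiff c d).
rewrite /diff_le; move: (repr (mkdiff a b)) (repr (mkdiff c d)) h1 h2 => p q h1 h2.
rewrite -(infl_leD2 (b + d)%R) -[RHS](infl_leD2 (p.2 + q.2)%R).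
congr infl_le.
  by rewrite addrACA h1 [(q.2 + d)%R]addrC [RHS]addrACA.
rewrite [(b + d)%R]addrC addrACA h2 [(p.2 + q.2)%R]addrC [RHS]addrACA.
by rewrite [(p.2 + b)%R]addrC.
Qed.

Fact diff_le_refl : reflexive diff_le.
Proof. by move=> x; rewrite -(diff_repr x) diff_leE /infl_le mvle_refl. Qed.
Fact diff_le_anti : antisymmetric diff_le.
Proof.
move=> x y; rewrite -(diff_repr x) -(diff_repr y) !diff_leE => /andP[h1 h2].
by apply/diffP/val_inj/mvle_anti.
Qed.
Fact diff_le_trans : transitive diff_le.
Proof.
move=> y x z; rewrite -(diff_repr x) -(diff_repr y) -(diff_repr z) !diff_leE.
move: (repr x) (repr y) (repr z) => [a b] [c d] [e f] /= h1 h2.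
rewrite -(infl_leD2 d) addrAC [(e + b + d)%R]addrAC.
apply: (@infl_le_trans (c + b + f)%R); first by rewrite infl_leD2.
by rewrite [(c + b + f)%R]addrAC infl_leD2.
Qed.

Definition diff_join (x y : diff_group) : diff_group :=
  mkdiff (infl_join ((repr x).1 + (repr y).2) ((repr y).1 + (repr x).2))%R
       ((repr x).2 + (repr y).2)%R.
Definition diff_meet (x y : diff_group) : diff_group :=
  (- diff_join (- x) (- y))%R.

HB.instance Definition _ := Order.Le_isPOrder.Build ring_display diff_group
  diff_le_refl diff_le_anti diff_le_trans.

Lemma diff_leN (x y : diff_group) : ((- x <= - y)%R = (y <= x)%R).
Proof.
rewrite -(diff_repr x) -(diff_repr y) /Order.le /= /GRing.opp /= !diff_oppE.
by rewrite !diff_leE addrC [X in infl_le _ X]addrC.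
Qed.

Lemma diff_leD2 (z x y : diff_group) : ((x + z <= y + z)%R = (x <= y)%R).
Proof.
rewrite -(diff_repr x) -(diff_repr y) -(diff_repr z).
rewrite /Order.le /= /GRing.add /= !diff_addE !diff_leE.
by rewrite addrACA [X in infl_le _ X]addrACA infl_leD2.
Qed.

Fact diff_joinP (x y z : diff_group) :
  ((diff_join x y <= z)%R = (x <= z)%R && (y <= z)%R).
Proof.
rewrite -[X in (X <= z)%R && _](diff_repr x) -[X in _ && (X <= z)%R](diff_repr y).
rewrite -(diff_repr z) /diff_join.
move: (repr x) (repr y) (repr z) => [a b] [c d] [e f] /=.
rewrite /Order.le /= !diff_leE infl_join_le.
rewrite -[in RHS](infl_leD2 d (a + f)%R) -[in RHS](infl_leD2 b (c + f)%R).
by congr (infl_le _ _ && infl_le _ _); rewrite ?addrA // addrAC.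
Qed.

Fact diff_meetP (x y z : diff_group) :
  ((x <= diff_meet y z)%R = (x <= y)%R && (x <= z)%R).
Proof.
by rewrite -[x in LHS]opprK diff_leN diff_joinP !diff_leN.
Qed.

HB.instance Definition _ := Order.POrder_MeetJoin_isLattice.Build ring_display
  diff_group diff_meetP diff_joinP.

End Stalk.

Arguments mkdiff {B M} a b.

(* Right inverse to the natural projection B/O_M -> B/M means: whenever
   j x = b/O_M, one has x = b/M. *)
Definition retraction_at (B : mvType) (M : maxspec B) :=
  {j : quo M -> quo (germ M) |
    mv_embedding j /\ forall x b, j x = cls (germ M) b -> cls M b = x}.

Definition retractions (B : mvType) := forall M : maxspec B, retraction_at M.

Section Sheaf.
Variables (R : realType) (B : mvType) (j : retractions B).
Implicit Types (b c : B) (M : maxspec B).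

(* b/M, identified with its image in B/O_M *)
Definition std_part b M : quo (germ M) := sval (j M) (cls M b).

Fact std_part_subproof b M :
  germ_image (cls (germ M) b ⊖ std_part b M) /\
  germ_image (std_part b M ⊖ cls (germ M) b).
Proof.
rewrite /std_part; case: (j M) => f [_ fK] /=.
have := cls_repr (f (cls M b)); move: (repr _) => c /esym ec.
have /clsP[h1 h2] := fK _ _ ec.
by rewrite ec -!clsB; split; [exists (b ⊖ c)|exists (c ⊖ b)].
Qed.

Definition g_pos b M : infl M := SigSub (mem_set (std_part_subproof b M).1).
Definition g_neg b M : infl M := SigSub (mem_set (std_part_subproof b M).2).
Definition g_stalk b M : diff_group M := mkdiff (g_pos b M) (g_neg b M).

Definition H_set : set {M : maxspec B & diff_group M} :=
  [set existT _ M (g_stalk b M) | b in setT & M in setT].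
Definition H_space := set_type H_set.

Definition H_proj (y : H_space) : maxspec B := projT1 (\val y).

Fact H_section_subproof b M : H_set (existT _ M (g_stalk b M)).
Proof. by exists b => //; exists M. Qed.
Definition H_section b (M : maxspec B) : H_space :=
  SigSub (mem_set (H_section_subproof b M)).

Definition H_topology : set (fuzzy R H_space) :=
  generated_mv_topology
    [set fuzzy_image (H_section b) (hat R c) | b in setT & c in setT].

Definition section_family b : forall M : maxspec B, I01 R * diff_group M :=
  fun M => (hat R b M, g_stalk b M).

Definition sections := set_type (range section_family).
HB.instance Definition _ := Choice.on sections.

Definition global_section b : sections := SigSub (mem_set (imageT section_family b)).

End Sheaf.

Definition with_mv (T : choiceType) (m : isMVAlgebra T) : mvType := HB.pack T m.

(* The operations on sections are prescribed on representatives: the family of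
   b plus that of c is the family of [b ⊕ c], and so on. As [global_section] is
   onto, at most one structure [m] satisfies this; that one does is the
   well-definedness of these operations. *)
Definition is_section_algebra (R : realType) (B : mvType) (j : retractions B)
    (m : isMVAlgebra (sections R j)) : Prop :=
  mv_morphism (global_section R j : B -> with_mv m).

(* Main.v *)
Require Import Defs.
From mathcomp Require Import all_boot all_order all_algebra.
From mathcomp Require Import boolp classical_sets reals.
From HB Require Import structures.
From mathcomp Require Import lra ring zify.

Set Implicit Arguments.
Unset Strict Implicit.
Unset Printing Implicit Defensive.

Import Order.TTheory GRing.Theory Num.Theory.

Local Open Scope classical_set_scope.
Local Open Scope mv_scope.

(** If an MV-algebra B receives a morphism from [0,1], then every simple
    quotient of B or of a stalk of B is a copy of [0,1] through that morphism.
    As each stalk B/O_M has a unique maximal ideal, B is locally retractive.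
    Moreover b/M and g_bM determine b/O_M, and the ideals O_M intersect in 0, so
    b is determined by its family of sections and the section algebra is a copy
    of B.

    It remains to embed A into such a B.  Take B = [0,1]^X / J with
    X = [0,1]^A, where J is generated by the term functions of the terms that
    vanish in A; that A embeds is Chang's completeness theorem.  A term that does
    not vanish in A does not vanish in some totally ordered quotient of A, hence
    gives a finite system of linear inequalities solvable in Chang's ordered
    group of that chain; Fourier-Motzkin elimination solves it in the reals. *)

(** * Arithmetic, ideals and germs *)

Section Arithmetic.
Variable B : mvType.
Implicit Types x y z w : B.

Lemma mvnegone : (mvone : B)^* = mvzero.
Proof. exact: mvnegK. Qed.

Lemma mv0le x : mvle mvzero x.
Proof. by rewrite -[x]mvadd0x mvle_add. Qed.

Lemma mvle1 x : mvle x mvone.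
Proof. by rewrite mvleE mvaddx1. Qed.

Lemma mv1le x : mvle mvone x -> x = mvone.
Proof. exact/mvle_anti/mvle1. Qed.

Lemma mvsubx0 x : x ⊖ mvzero = x.
Proof. by rewrite /mvsub /mvmul mvnegK mvaddx0 mvnegK. Qed.

Lemma mvmulC x y : x ⊙ y = y ⊙ x.
Proof. by rewrite /mvmul mvaddC. Qed.

Lemma mvmulA x y z : x ⊙ (y ⊙ z) = x ⊙ y ⊙ z.
Proof. by rewrite /mvmul !mvnegK mvaddA. Qed.

Lemma mvmulxN x : x ⊙ x^* = mvzero.
Proof. by rewrite /mvmul mvaddxN mvnegone. Qed.

Lemma mvnegD x y : (x ⊕ y)^* = x^* ⊙ y^*.
Proof. by rewrite /mvmul !mvnegK. Qed.

Lemma mvnegM x y : (x ⊙ y)^* = x^* ⊕ y^*.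
Proof. by rewrite /mvmul !mvnegK. Qed.

Lemma mvleN x y : mvle x^* y^* = mvle y x.
Proof. by rewrite !mvleE mvnegK mvaddC. Qed.

Lemma mvle_mul2 x y z w : mvle x y -> mvle z w -> mvle (x ⊙ z) (y ⊙ w).
Proof. by move=> h1 h2; rewrite mvleN mvle_add2 // mvleN. Qed.

Lemma mvle_mull x y : mvle (x ⊙ y) x.
Proof. by rewrite -(mvnegK y) mvle_subl. Qed.

Lemma mvle_sub2l x y z : mvle x y -> mvle (z ⊖ y) (z ⊖ x).
Proof. by move=> h; rewrite mvle_mul2 ?mvle_refl // mvleN. Qed.

Lemma mvmul_eq0 x y : (x ⊙ y == mvzero) = mvle x y^*.
Proof. by rewrite /mvle /mvsub mvnegK. Qed.

Lemma mvadd_eq1 x y : (x ⊕ y == mvone) = mvle x^* y.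
Proof. by rewrite mvleE mvnegK. Qed.

(* Both sides are x ∧ y. *)
Lemma mvsubsubC x y : x ⊖ (x ⊖ y) = y ⊖ (y ⊖ x).
Proof.
rewrite /mvsub /mvmul !mvnegK (mvaddC x^* y) (mvaddC y^* x) (mvaddC x^*).
by rewrite (mvaddC y^*); have := mvjoin_sym x^* y^*; rewrite !mvnegK => ->.
Qed.

Lemma mvsubsub_le x y : mvle (x ⊖ (x ⊖ y)) y.
Proof. by rewrite mvsubsubC mvle_subl. Qed.

Lemma mvle_subsub x y : mvle x y -> y ⊖ (y ⊖ x) = x.
Proof. by move=> /eqP h; rewrite mvsubsubC h mvsubx0. Qed.

Lemma mvsubsubK x y : (x ⊖ (x ⊖ y)) ⊕ (x ⊖ y) = x.
Proof. by have := mvle_join (mvle_subl x y); rewrite mvjoinC. Qed.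

(** This is x ∧ y = 0, phrased through lower bounds so that no meet has to be computed. *)
Definition mvdisjoint x y := forall w, mvle w x -> mvle w y -> w = mvzero.

Lemma mvdisjointC x y : mvdisjoint x y -> mvdisjoint y x.
Proof. by move=> h w wy wx; apply: h. Qed.

(** With m = x ∧ y, an element w below both differences satisfies w ⊙ m = 0 and w ⊕ m ≤ m;
    cancelling m leaves w = 0. *)
Lemma mvdisjoint_sub x y : mvdisjoint (x ⊖ y) (y ⊖ x).
Proof.
move=> w wx wy; set m := x ⊖ (x ⊖ y).
have mE : m = y ⊖ (y ⊖ x) by rewrite /m mvsubsubC.
have m0 : w ⊙ m = mvzero.
  apply: mvle0; apply: mvle_trans (mvle_mul2 wx (mvsubsub_le x y)) _.
  by rewrite -mvmulA [y^* ⊙ y]mvmulC mvmulxN mvmulC mvle_mull.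
rewrite -(mvaddK m0); apply/eqP.
rewrite -[_ == _]/(mvle _ _) -[X in mvle _ X](_ : x ⊖ (x ⊖ y) = m) //.
have hx : mvle (w ⊕ m) x.
  by rewrite -[X in mvle _ X](mvsubsubK x y) mvaddC mvle_add2 ?mvle_refl.
have hy : mvle (w ⊕ m) y.
  by rewrite -[X in mvle _ X](mvsubsubK y x) mvaddC -mE mvle_add2 ?mvle_refl.
by rewrite -(mvle_subsub hx) mvle_sub2l // mvle_sub2l.
Qed.

(** If w lies below x ⊕ y and z, then w ⊖ x lies below y and z, hence vanishes; so w ≤ x. *)
Lemma mvdisjointD x y z :
  mvdisjoint x z -> mvdisjoint y z -> mvdisjoint (x ⊕ y) z.
Proof.
move=> xz yz w wxy wz; apply: (xz _ _ wz); apply/eqP/yz.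
  by rewrite mvle_sub_add.
exact: mvle_trans (mvle_subl _ _) wz.
Qed.

Lemma mvdisjoint_le x y z : mvdisjoint x z -> mvle z (x ⊕ y) -> mvle z y.
Proof.
move=> xz zxy; apply/eqP/xz; last exact: mvle_subl.
by rewrite mvle_sub_add mvaddC.
Qed.

Fixpoint mvmuln n x := if n is n'.+1 then x ⊕ mvmuln n' x else mvzero.

Lemma mvmulnD m n x : mvmuln (m + n) x = mvmuln m x ⊕ mvmuln n x.
Proof. by elim: m => [|m IH] /=; rewrite ?mvadd0x // IH mvaddA. Qed.

Lemma mvle_muln n x y : mvle x y -> mvle (mvmuln n x) (mvmuln n y).
Proof. by move=> xy; elim: n => [|n IH] /=; rewrite ?mvle_refl ?mvle_add2. Qed.

Lemma mvdisjoint_muln n x y : mvdisjoint x y -> mvdisjoint (mvmuln n x) y.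
Proof.
move=> xy; elim: n => [w /mvle0 //|n IH] /=; exact: mvdisjointD.
Qed.

(* In a distributive lattice x ∨ s and x ∧ s determine x. *)
Lemma mvsub_inj s x y : x ⊖ s = y ⊖ s -> s ⊖ x = s ⊖ y -> x = y.
Proof.
have le u v : u ⊖ s = v ⊖ s -> s ⊖ u = s ⊖ v -> mvle u v.
  move=> e1 e2; rewrite -[u](mvsubsubK u s) mvsubsubC e2 e1 mvsubsubC.
  by rewrite mvsubsubK mvle_refl.
by move=> e1 e2; apply: mvle_anti; apply: le.
Qed.

(* x ⊖ s and s ⊖ x are disjoint, as the parts of an element of an ℓ-group. *)
Lemma mvsub_cross_inj s x y :
  (x ⊖ s) ⊕ (s ⊖ y) = (y ⊖ s) ⊕ (s ⊖ x) -> x = y.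
Proof.
have le u v : (u ⊖ s) ⊕ (s ⊖ v) = (v ⊖ s) ⊕ (s ⊖ u) ->
    mvle (u ⊖ s) (v ⊖ s) /\ mvle (s ⊖ u) (s ⊖ v).
  move=> e; split.
    apply: (@mvdisjoint_le (s ⊖ u)); first exact: mvdisjoint_sub.
    by rewrite mvaddC -e mvle_add.
  apply: (@mvdisjoint_le (u ⊖ s)); first exact: mvdisjoint_sub.
  by rewrite e mvle_addr.
move=> e; have [p1 n1] := le _ _ e; have [p2 n2] := le _ _ (esym e).
by apply: (@mvsub_inj s); apply: mvle_anti.
Qed.

End Arithmetic.

(** * Existence of maximal, prime and minimal prime ideals *)

Lemma Zorn_above (T : Type) (P : set (set T)) (I : set T) : P I ->
  (forall F : set (set T), F `<=` P -> F !=set0 -> total_on F subset ->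
     P (\bigcup_(X in F) X)) ->
  exists A, [/\ P A, I `<=` A & forall B, P B -> A `<=` B -> B = A].
Proof.
(* Taking the sets S with S ∪ I in P lets I itself serve as the bound of the empty chain. *)
move=> PI Pcup; have [|A [PA maxA]] := @Zorn_bigcup T [set S | P (S `|` I)].
  move=> F FP Ftot; have [->|/set0P[S0 FS0]] := eqVneq F set0.
    by rewrite /= bigcup_set0 set0U.
  rewrite /=; have -> : (\bigcup_(X in F) X) `|` I =
            \bigcup_(X in [set S `|` I | S in F]) X.
    apply/seteqP; split=> [x [[S FS Sx]|Ix]|x [_ [S FS <-] [Sx|Ix]]].
    - by exists (S `|` I); [exists S|left].
    - by exists (S0 `|` I); [exists S0|right].
    - by left; exists S.
    - by right.
  apply: Pcup => [_ [S FS <-]||_ _ [S FS <-] [S' FS' <-]].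
  - exact: FP.
  - by exists (S0 `|` I), S0.
  - by have [h|h] := Ftot _ _ FS FS'; [left|right]; apply: setSU.
exists (A `|` I); split=> // C PC AC.
have ICC : C `|` I = C by apply/setUidPl => x Ix; apply: AC; right.
apply: contrapT => nCA; apply: (maxA C); last by rewrite /= ICC.
split=> [x Ax|CA]; first by apply: AC; left.
by apply: nCA; apply/seteqP; split=> // x /CA; left.
Qed.

Section Ideals.
Variable B : mvType.
Implicit Types (x y b : B) (I J P Q M : set B).

Lemma ideal_properP I : is_ideal I -> I != setT <-> ~ I mvone.
Proof.
move=> [_ _ Ile]; split=> [/eqP nT I1|nI1]; last first.
  by apply/eqP => e; apply: nI1; rewrite e.
by apply: nT; apply/seteqP; split=> // x _; apply: Ile I1; apply: mvle1.
Qed.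

Lemma bigcup_ideal (F : set (set B)) : F !=set0 -> total_on F subset ->
  (forall I, F I -> is_ideal I) -> is_ideal (\bigcup_(I in F) I).
Proof.
move=> [I0 FI0] Ftot Fid; split.
- by exists I0 => //; have [] := Fid _ FI0.
- move=> x y [I FI Ix] [J FJ Jy]; have [h|h] := Ftot _ _ FI FJ.
    by exists J => //; have [_ + _] := Fid _ FJ; apply=> //; apply: h.
  by exists I => //; have [_ + _] := Fid _ FI; apply=> //; apply: h.
- move=> x y xy [I FI Iy]; exists I => //; have [_ _] := Fid _ FI.
  by apply; [exact: xy|].
Qed.

(** The union of a chain of ideals avoiding b avoids b. The case b = 1 yields maximal ideals, the
    case I = 0 primes that miss b. *)
Lemma ideal_avoiding I b : is_ideal I -> ~ I b ->
  exists P, [/\ is_ideal P, ~ P b, I `<=` P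
    & forall J, is_ideal J -> ~ J b -> P `<=` J -> J = P].
Proof.
move=> iI Ib.
have [|F FP F0 Ftot|P [[iP Pb] IP Pmax]] :=
    @Zorn_above B [set P | is_ideal P /\ ~ P b] I.
- by [].
- split; first by apply: bigcup_ideal => // J /FP[].
  by move=> [J /FP[_ nJb]] /nJb.
- by exists P; split=> // J iJ Jb; apply: Pmax.
Qed.

(** This set is the ideal generated by P and a. *)
Lemma ideal_adjoin_ideal P a : is_ideal P ->
  is_ideal [set x | exists p n, P p /\ mvle x (p ⊕ mvmuln n a)].
Proof.
move=> [P0 PD Ple]; split.
- by exists mvzero, 0%N; rewrite mv0le.
- move=> x y [p [m [Pp xp]]] [q [n [Pq yq]]]; exists (p ⊕ q), (m + n)%N.
  split; first exact: PD.
  apply: mvle_trans (mvle_add2 xp yq) _.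
  by rewrite mvmulnD -!mvaddA (mvaddA _ q) (mvaddC _ q) -mvaddA mvle_refl.
- move=> x y xy [p [m [Pp yp]]]; exists p, m; split=> //.
  exact: mvle_trans xy yp.
Qed.

(** By maximality of P, the ideal generated by P and a must contain b. *)
Lemma ideal_avoiding_adjoin P b a : is_ideal P ->
  (forall J, is_ideal J -> ~ J b -> P `<=` J -> J = P) -> ~ P a ->
  exists p n, P p /\ mvle b (p ⊕ mvmuln n a).
Proof.
move=> iP Pmax Pa; apply: contrapT => nb; apply: Pa.
have [P0 _ _] := iP; rewrite -(Pmax _ (ideal_adjoin_ideal a iP) nb).
  by exists mvzero, 1%N; rewrite /= mvadd0x mvaddx0 mvle_refl.
by move=> x Px; exists x, 0%N; rewrite /= mvaddx0 mvle_refl.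
Qed.

(** If P missed both x ⊖ y and y ⊖ x, then b would lie below p ⊕ m(x ⊖ y) and below q ⊕ n(y ⊖ x)
    with p, q in P. These multiples are disjoint, so b ≤ p ⊕ q, which puts b in P. *)
Lemma ideal_avoiding_prime P b : is_ideal P -> ~ P b ->
  (forall J, is_ideal J -> ~ J b -> P `<=` J -> J = P) -> prime_ideal P.
Proof.
move=> iP Pb Pmax; have [P0 PD Ple] := iP; split=> //.
  by apply/eqP => e; apply: Pb; rewrite e.
have adj := ideal_avoiding_adjoin iP Pmax.
move=> x y; apply: contrapT => /not_orP[/adj + /adj].
move=> [p [m [Pp bp]]] [q [n [Pq bq]]]; apply: Pb.
apply: (Ple _ (p ⊕ q)); last exact: PD.
have := @mvdisjoint_sub _ x y => /(@mvdisjoint_muln _ m)/mvdisjointC.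
move=> /(@mvdisjoint_muln _ n) disj; apply/eqP/disj; rewrite mvle_sub_add.
  by apply: mvle_trans bq _; rewrite mvle_add2 ?mvle_refl // mvle_addr.
by apply: mvle_trans bp _; rewrite mvle_add2 ?mvle_refl // mvle_add.
Qed.

Lemma prime_avoiding b : b <> mvzero -> exists P, prime_ideal P /\ ~ P b.
Proof.
move=> b0; have i0 : is_ideal [set mvzero : B].
  split=> // [x y -> ->|x y xy y0]; first exact: mvadd0x.
  by apply: mvle0; rewrite -y0.
have [P [iP Pb _ Pmax]] := ideal_avoiding i0 b0.
by exists P; split=> //; apply: ideal_avoiding_prime Pmax.
Qed.

Lemma maximal_above I : is_ideal I -> ~ I mvone ->
  exists M : maxspec B, I `<=` M.
Proof.
move=> iI /(ideal_avoiding iI)[M [iM M1 IM Mmax]].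
have mM : maximal_ideal M.
  split=> //; first exact/ideal_properP.
  by move=> J iJ /(ideal_properP iJ); apply: Mmax.
by exists (@MaxSpec B (MVIdeal iM) mM).
Qed.

Lemma maximal_adjoin (M : maxspec B) x : ~ M x ->
  exists p n, M p /\ p ⊕ mvmuln n x = mvone.
Proof.
move=> Mx; have [iM nT Mmax] := max_idealP M.
have [|p [n [Mp h]]] := @ideal_avoiding_adjoin M mvone x iM _ Mx.
  by move=> J iJ J1; apply: Mmax => //; apply/ideal_properP.
by exists p, n; split=> //; apply: mv1le.
Qed.

Lemma maximal_prime (M : maxspec B) : prime_ideal M.
Proof.
have [iM nT Mmax] := max_idealP M.
apply: (@ideal_avoiding_prime M mvone) => //; first exact: max_not1.
by move=> J iJ J1; apply: Mmax => //; apply/ideal_properP.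
Qed.

(** Zorn's lemma runs on complements, where unions of chains become intersections of chains of
    primes. *)
Lemma minimal_prime_below P : prime_ideal P ->
  exists Q, minimal_prime Q /\ Q `<=` P.
Proof.
move=> pP.
have [|F FP [S0 FS0] Ftot|A [pA PA Amin]] :=
    @Zorn_above B [set S | prime_ideal (~` S)] (~` P).
- by rewrite /= setCK.
- rewrite /= setC_bigcup; have [iS0 /(ideal_properP iS0) S01 _] := FP _ FS0.
  have idS S : F S -> is_ideal (~` S) by move=> /FP[].
  split.
  + split=> [S /idS[]//|x y hx hy S FS|x y xy hy S FS].
      by have [_ + _] := idS _ FS; apply; [apply: hx|apply: hy].
    by have [_ _] := idS _ FS; apply; [exact: xy|exact: hy].
  + apply/eqP => e; apply: S01.
    by have : setT (mvone : B) by []; rewrite -e; apply.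
  (* If one prime of the chain misses x ⊖ y and another misses y ⊖ x, the smaller of the two misses
     both. *)
  + move=> x y; apply: contrapT => /not_orP[h1 h2].
    have [S FS Sx] : exists2 S, F S & S (x ⊖ y).
      by apply: contrapT => h; apply: h1 => S FS Sx; apply: h; exists S.
    have [S' FS' Sy] : exists2 S, F S & S (y ⊖ x).
      by apply: contrapT => h; apply: h2 => S' FS' Sy; apply: h; exists S'.
    have [SS'|S'S] := Ftot _ _ FS FS'.
      by have [_ _ /(_ x y)[]] := FP _ FS' => [/(_ (SS' _ Sx))|/(_ Sy)].
    by have [_ _ /(_ x y)[]] := FP _ FS => [/(_ Sx)|/(_ (S'S _ Sy))].
- exists (~` A); split; last by rewrite -[P]setCK; apply: subsetC.
  split=> // Q pQ QA; rewrite -(Amin (~` Q)) /= ?setCK //.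
  by rewrite -[A]setCK; apply: subsetC.
Qed.

End Ideals.

Section Morphisms.
Variables (B C : mvType) (f : B -> C).
Hypothesis fM : mv_morphism f.

Lemma mvmorph0 : f mvzero = mvzero. Proof. by have [] := fM. Qed.
Lemma mvmorphD x y : f (x ⊕ y) = f x ⊕ f y. Proof. by have [] := fM. Qed.
Lemma mvmorphN x : f x^* = (f x)^*. Proof. by have [] := fM. Qed.
Lemma mvmorph1 : f mvone = mvone. Proof. by rewrite mvmorphN mvmorph0. Qed.
Lemma mvmorphB x y : f (x ⊖ y) = f x ⊖ f y.
Proof. by rewrite /mvsub /mvmul !(mvmorphN, mvmorphD). Qed.
Lemma mvmorph_le x y : mvle x y -> mvle (f x) (f y).
Proof. by move=> /eqP h; rewrite /mvle -mvmorphB h mvmorph0. Qed.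
Lemma mvmorphMn n x : f (mvmuln n x) = mvmuln n (f x).
Proof. by elim: n => [|n IH] /=; rewrite ?mvmorph0 // mvmorphD IH. Qed.

Lemma mvmorph_inj : (forall x, f x = mvzero -> x = mvzero) -> injective f.
Proof.
move=> f0 x y fxy.
by apply: mvle_anti; apply/eqP/f0; rewrite mvmorphB fxy mvsubxx.
Qed.

End Morphisms.

Lemma comp_morphism (A B C : mvType) (g : B -> C) (f : A -> B) :
  mv_morphism g -> mv_morphism f -> mv_morphism (g \o f).
Proof.
move=> [g0 gD gN] [f0 fD fN]; split=> [|x y|x] /=.
- by rewrite f0.
- by rewrite fD gD.
- by rewrite fN gN.
Qed.

Lemma cls_morphism (B : mvType) (I : mvideal B) : mv_morphism (cls I).
Proof. by split=> // *; rewrite (clsD, clsN). Qed.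

(** * The stalks B/O_M are local and separate the elements of B *)

Section Germs.
Variable B : mvType.
Implicit Types (x y b : B) (M N : maxspec B).

Lemma maxspec_sub_eq M N : M `<=` N -> ideal_set N = M.
Proof.
by move=> MN; have [_ _ h] := max_idealP M; apply: h => //; have [] := max_idealP N.
Qed.

Lemma germ_sub M : germ M `<=` M.
Proof.
have [Q [mQ QM]] := minimal_prime_below (maximal_prime M).
by move=> x gx; apply: (QM); exact: (gx Q (conj mQ QM)).
Qed.

(* If x is in M but not in N, a multiple a of x satisfies a ∈ M and a^* ∈ N;
   then a ⊖ a^* is outside N, yet lies in each prime contained in M, since the
   disjoint element a^* ⊖ a does not. *)
Lemma germ_sub_maximal M N : germ M `<=` N -> M `<=` N.
Proof.
move=> gN x Mx; apply: contrapT => /maximal_adjoin[p [n [Np pn1]]].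
set a := mvmuln n x in pn1.
have Ma : M a.
  by rewrite /a; elim: (n) => [|k IH] /=; [exact: ideal0|exact: idealD].
have Na : N a^*.
  by apply: ideal_le Np; rewrite -mvadd_eq1 mvaddC pn1.
apply: (@max_not1 _ N); rewrite -pn1; apply: idealD => //.
apply: ideal_le (mvle_addsub a a^*) _; apply: idealD => //.
apply: gN => Q [[[_ _ pQ] _] QM]; have [//|/QM h] := pQ a a^*.
case: (@max_not1 _ M); rewrite -(mvaddxN a); apply: idealD => //.
by apply: ideal_le (mvle_addsub a^* a) _; apply: idealD.
Qed.

(** A nonzero b is missed by some prime P. A minimal prime inside P misses b too, and it takes part
    in O_M for any maximal M above P. *)
Lemma germ_separates b : (forall M, germ M b) -> b = mvzero.
Proof.
move=> gb; apply: contrapT => /prime_avoiding[P [pP Pb]].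
have [iP /(ideal_properP iP) P1 _] := pP.
have [M PM] := maximal_above iP P1; have [Q [mQ QP]] := minimal_prime_below pP.
have QM : Q `<=` M by move=> z /QP/PM.
exact: Pb (QP _ (gb M Q (conj mQ QM))).
Qed.

Lemma germs_inj b c : (forall M, cls (germ M) b = cls (germ M) c) -> b = c.
Proof.
by move=> h; apply: mvle_anti; apply/eqP/germ_separates => M; have /clsP[] := h M.
Qed.

Lemma pullback_ideal (I : mvideal B) (J : set (quo I)) : is_ideal J ->
  is_ideal [set a | J (cls I a)].
Proof.
move=> [J0 JD Jle]; split=> //= [x y Jx Jy|x y xy Jy].
  by rewrite clsD; apply: JD.
by apply: Jle Jy; rewrite /mvle -clsB (eqP xy).
Qed.

(** Since O_M ⊆ M, membership in M depends only on the class modulo O_M. *)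
Lemma germ_image_cls M a : germ_image (cls (germ M) a) <-> M a.
Proof.
split=> [[b Mb /esym/clsP[/germ_sub h _]]|Ma]; last by exists a.
by apply: ideal_le (mvle_addsub a b) _; apply: idealD.
Qed.

(** A proper ideal above M/O_M pulls back to a proper ideal above M, which is M itself. *)
Lemma germ_image_maximal M : maximal_ideal (@germ_image B M).
Proof.
have iG : is_ideal (@germ_image B M).
  by split; [exact: germ_image0|exact: germ_imageD|exact: germ_image_le].
split=> //.
  apply/ideal_properP => //; rewrite -(mvmorph1 (cls_morphism _)) => /germ_image_cls.
  exact: max_not1.
move=> J iJ /(ideal_properP iJ) J1 GJ; have [_ _ Mmax] := max_idealP M.
have JM : [set a | J (cls (germ M) a)] = M.
  apply: Mmax; first exact: pullback_ideal.
    apply/ideal_properP; first exact: pullback_ideal.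
    by rewrite /= (mvmorph1 (cls_morphism _)).
  by move=> a Ma; apply: GJ; apply/germ_image_cls.
apply/seteqP; split=> // x; rewrite -(cls_repr x) => Jx.
by apply/germ_image_cls; rewrite -JM.
Qed.

(** The pullback of N lies in a maximal ideal that contains O_M; by [germ_sub_maximal] this ideal is
    M, so N ⊆ M/O_M. *)
Lemma germ_local M (N : set (quo (germ M))) :
  maximal_ideal N -> N = @germ_image B M.
Proof.
move=> [iN /(ideal_properP iN) N1 Nmax].
have [|M' NM'] := maximal_above (pullback_ideal iN).
  by rewrite /= (mvmorph1 (cls_morphism _)).
have MM' : M `<=` M'.
  apply: germ_sub_maximal => a ga; apply: NM' => /=.
  by rewrite (proj2 (cls0P _ _) ga); have [] := iN.
have [iG /(ideal_properP iG) G1 _] := germ_image_maximal M.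
symmetry; apply: Nmax => //; first exact/ideal_properP.
move=> x; rewrite -(cls_repr x) => Nx; apply/germ_image_cls.
by rewrite -(maxspec_sub_eq MM'); apply: NM'.
Qed.

(** The radical is the single maximal ideal M/O_M, so facts about quotients by maximal ideals apply
    to the quotient of the stalk by its radical. *)
Lemma Rad_germ_maximal M : maximal_ideal (Rad (quo (germ M))).
Proof.
rewrite /= (_ : \bigcap_(I in _) I = @germ_image B M).
  exact: germ_image_maximal.
apply/seteqP; split=> [x|x Gx N /germ_local -> //].
by apply; apply: germ_image_maximal.
Qed.

End Germs.

Lemma quo_maximal_simple (B : mvType) (M : maxspec B) (x : quo M) :
  x <> mvzero -> exists n, mvmuln n x = mvone.
Proof.
rewrite -(cls_repr x) => /cls0P/maximal_adjoin[p [n [Mp h]]]; exists n.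
rewrite -(mvmorphMn (cls_morphism M)) -(mvmorph1 (cls_morphism M)) -h clsD.
by rewrite (proj2 (cls0P _ _) Mp) mvadd0x.
Qed.

Lemma quo_maximal_nontrivial (B : mvType) (M : maxspec B) :
  (mvone : quo M) <> mvzero.
Proof.
by rewrite -(mvmorph1 (cls_morphism M)) => /cls0P; apply: max_not1.
Qed.

Lemma quo_prime_total (B : mvType) (P : mvideal B) (x y : quo P) :
  prime_ideal P -> mvle x y || mvle y x.
Proof.
move=> [_ _ /(_ (repr x) (repr y)) Pxy]; rewrite -(cls_repr x) -(cls_repr y).
apply/orP; rewrite /mvle -!clsB.
by case: Pxy => /cls0P ->; [left|right].
Qed.

(** * Algebras over the unit interval *)

Section UnitIntervalAlgebra.
Variable R : realType.
Local Open Scope ring_scope.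
Local Open Scope mv_scope.
Implicit Types x y : I01 R.

Lemma i01_ge0 x : 0 <= val x. Proof. by case/andP: (valP x). Qed.
Lemma i01_le1 x : val x <= 1. Proof. by case/andP: (valP x). Qed.

Lemma val_i010 : val (mvzero : I01 R) = 0. Proof. by []. Qed.

Lemma val_i011 : val (mvone : I01 R) = 1. Proof. exact: subr0. Qed.

Lemma val_i01D x y : val (x ⊕ y) = Num.min 1 (val x + val y).
Proof. by []. Qed.

Lemma val_i01N x : val x^* = 1 - val x.
Proof. by []. Qed.

Lemma val_i01B x y : val (x ⊖ y) = Num.max 0 (val x - val y).
Proof.
have := i01_ge0 x; have := i01_le1 x; have := i01_ge0 y; have := i01_le1 y.
rewrite /mvsub /mvmul mvnegK val_i01N val_i01D val_i01N.
move: (val x) (val y) => a b *.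
by case: (leP 1 (1 - a + b)) => ?; case: (leP 0 (a - b)) => ?; lra.
Qed.

Lemma i01_leE x y : mvle x y = (val x <= val y).
Proof.
apply/eqP/idP => [/(congr1 val)|xy]; last apply: val_inj.
  by rewrite val_i01B val_i010; case: (leP 0 (val x - val y)) => *; lra.
by rewrite val_i01B val_i010; case: (leP 0 (val x - val y)) => *; lra.
Qed.

Definition mk01 (r : R) (h : 0 <= r <= 1) : I01 R := exist _ r h.

Lemma val_i01_muln n x : val (mvmuln n x) = Num.min 1 (val x *+ n).
Proof.
have x0 := i01_ge0 x.
elim: n => [|n IH]; first by rewrite val_i010 mulr0n; case: leP => //; lra.
rewrite -[mvmuln _ x]/(x ⊕ mvmuln n x) val_i01D IH mulrS.
have xn0 : 0 <= val x *+ n by rewrite mulrn_wge0.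
case: (leP 1 (val x *+ n)) => h //.
by rewrite !(min_idPl _) //; lra.
Qed.

Lemma i01_small n : exists2 x : I01 R, 0 < val x & mvmuln n x <> mvone.
Proof.
(* The witness is 1/(n+1), whose n-fold sum n/(n+1) stays below 1. *)
have h : 0 <= (n.+1%:R^-1 : R) <= 1.
  by rewrite invr_ge0 ler0n /= invf_le1 ?ltr0n // ler1n.
exists (mk01 h); first by rewrite /= invr_gt0 ltr0n.
move=> /(congr1 val); rewrite val_i01_muln val_i011 /= => e.
have lt1 : (n.+1%:R^-1 *+ n < 1 :> R).
  by rewrite -[_^-1 *+ n]mulr_natl ltr_pdivrMr ?ltr0n // mul1r ltr_nat.
by move: e; rewrite (min_idPr (ltW lt1)) => e; rewrite e ltxx in lt1.
Qed.

Lemma i01_archimedean x : x <> mvzero -> exists n, mvmuln n x = mvone.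
Proof.
move=> x0; have xp : 0 < val x.
  by rewrite lt_neqAle i01_ge0 andbT eq_sym; apply/eqP => e; apply/x0/val_inj.
exists (Num.bound (val x)^-1); apply: val_inj; rewrite val_i01_muln val_i011.
apply: min_idPl; rewrite -mulr_natl -ler_pdivrMr // mul1r.
by apply/ltW/archi_boundP; rewrite invr_ge0 ltW.
Qed.

(** * A simple chain that receives [0,1] is a copy of it *)

Section SimpleQuotient.
Variables (K : mvType) (e : I01 R -> K).
Hypotheses (eM : mv_morphism e)
  (Ksimple : forall x : K, x <> mvzero -> exists n, mvmuln n x = mvone)
  (Knontrivial : (mvone : K) <> mvzero)
  (Ktotal : forall x y : K, mvle x y || mvle y x).

(** A nonzero x has a multiple equal to 1, so e x = 0 would force 1 = 0 in K. *)
Lemma i01_morphism_inj : injective e.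
Proof.
apply: (mvmorph_inj eM) => x ex0; apply: contrapT => /i01_archimedean[n xn].
apply: Knontrivial; rewrite -(mvmorph1 eM) -xn (mvmorphMn eM) ex0.
by elim: (n) => //= k ->; rewrite mvadd0x.
Qed.

(** If z were nonzero, some n z would be 1, and then n x = 1 for every x > 0, contrary to
    [i01_small]. *)
Lemma i01_infinitesimal0 (z : K) :
  (forall x, 0 < val x -> mvle z (e x)) -> z = mvzero.
Proof.
move=> ze; apply: contrapT => /Ksimple[n zn].
have [x x0 xn] := i01_small n; apply/xn/i01_morphism_inj.
rewrite (mvmorph1 eM) (mvmorphMn eM); apply: mv1le; rewrite -zn.
by apply: mvle_muln; apply: ze.
Qed.

(** The preimage is r, the supremum of the x with e x ≤ z. Both z ⊖ e r and e r ⊖ z lie below e x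
    for all x > 0, hence vanish. *)
Lemma i01_morphism_surj (z : K) : exists x, e x = z.
Proof.
pose S := [set x : I01 R | mvle (e x) z].
have S0 : S mvzero by rewrite /S /= (mvmorph0 eM) mv0le.
pose r := i01_sup S; have rE : val r = sup (val @` S) by [].
have hs : has_sup (val @` S).
  by split; [exists 0, mvzero|exists 1 => _ [y _ <-]; exact: i01_le1].
exists r; apply: mvle_anti; apply/eqP/i01_infinitesimal0 => x x0.
- rewrite mvle_sub_add.
  have [_ [y Sy <-] ry] := sup_adherent x0 hs; rewrite -rE in ry.
  apply: (@mvle_trans _ (e (y ⊕ x))).
    apply: (mvmorph_le eM); rewrite i01_leE val_i01D le_min i01_le1 andTb.
    by lra.
  by rewrite (mvmorphD eM) mvle_add2 ?mvle_refl.
- rewrite mvle_sub_add -(mvmorphD eM).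
  have [h|h] := leP 1 (val r + val x).
    rewrite (_ : r ⊕ x = mvone) ?(mvmorph1 eM) ?mvle1 //.
    by apply: val_inj; rewrite val_i01D val_i011; apply: min_idPl.
  (* Being strictly above the supremum r, the element r ⊕ x is outside S, so totality puts z below
     its image. *)
  have /orP[//|ez] := Ktotal z (e (r ⊕ x)).
  have : val (r ⊕ x) <= val r.
    by rewrite rE; apply: ub_le_sup; [exact: hs.2|exists (r ⊕ x)].
  by rewrite val_i01D (min_idPr (ltW h)) => ?; exfalso; lra.
Qed.

Lemma i01_morphism_section : exists g : K -> I01 R,
  mv_embedding g /\ forall z, e (g z) = z.
Proof.
have /choice[g gK] := i01_morphism_surj; exists g; split=> //.
split; last exact: can_inj gK.
split=> [|x y|x]; apply: i01_morphism_inj; rewrite gK.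
- by rewrite (mvmorph0 eM).
- by rewrite (mvmorphD eM) !gK.
- by rewrite (mvmorphN eM) gK.
Qed.

End SimpleQuotient.

Lemma quo_maximal_section (B : mvType) (e : I01 R -> B) (M : maxspec B) :
  mv_morphism e -> exists g : quo M -> I01 R,
    mv_embedding g /\ forall z, cls M (e (g z)) = z.
Proof.
move=> eM.
apply: (@i01_morphism_section _ (cls M \o e)).
- by apply: comp_morphism => //; apply: cls_morphism.
- exact: quo_maximal_simple.
- exact: quo_maximal_nontrivial.
- by move=> x y; apply: quo_prime_total; apply: maximal_prime.
Qed.

(** The composite of [0,1] → B → B/O_M with the projection modulo the radical is bijective. Its
    inverse, followed by [0,1] → B/O_M, is the section sought. *)
Lemma locally_retractive_unit (B : mvType) (e : I01 R -> B) :
  mv_morphism e -> locally_retractive B.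
Proof.
move=> eM M; set C := quo (germ M).
have cM : mv_morphism (cls (germ M) \o e).
  by apply: comp_morphism => //; apply: cls_morphism.
have [g [[gM _] gK]] :=
  @quo_maximal_section C _ (MaxSpec (Rad_germ_maximal M)) cM.
exists (cls (germ M) \o e \o g); split=> //; split.
  by do !apply: comp_morphism => //; apply: cls_morphism.
exact: (can_inj gK).
Qed.

(** * The section algebra is a copy of B *)

Section Sections.
Variables (B : mvType) (e : I01 R -> B) (j : retractions B).
Hypothesis eM : mv_morphism e.

(** The default value in the choice [point_embed] is excluded, because the inverse of [0,1] → B/M is
    an embedding. *)
Lemma point_embed_embedding (M : maxspec B) : mv_embedding (@point_embed R B M).
Proof.
have [g [gE _]] := quo_maximal_section M eM.
by apply: (@xgetPex _ _ [set f | mv_embedding f]); exists g.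
Qed.

(** Equal differences mean equal cross sums in M/O_M, and b and c share one standard part s;
    [mvsub_cross_inj] concludes. *)
Lemma g_stalk_inj (b c : B) (M : maxspec B) : cls M b = cls M c ->
  g_stalk j b M = g_stalk j c M -> cls (germ M) b = cls (germ M) c.
Proof.
move=> ebc /diffP/(congr1 val); rewrite !val_inflD /= /std_part ebc.
exact: mvsub_cross_inj.
Qed.

Lemma global_section_inj : injective (global_section R j).
Proof.
move=> b c /(congr1 val) /= ebc; apply: germs_inj => M.
have ebcM := congr1 (fun s => s M) ebc.
apply: g_stalk_inj (congr1 snd ebcM); have [_] := point_embed_embedding M; apply.
exact: (congr1 fst ebcM).
Qed.

Lemma global_section_surj (s : sections R j) : exists b, global_section R j b = s.
Proof.
case: s => s hs; have := hs; rewrite inE => -[b _ bs].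
by exists b; apply: val_inj.
Qed.

(** The operations of B are transported along the bijection [global_section], with [r] as its
    inverse. *)
Lemma section_algebra_exists : exists m : isMVAlgebra.axioms_ (sections R j),
  is_section_algebra m.
Proof.
have /choice[r rK] := global_section_surj.
have Kr : cancel (global_section R j) r.
  by move=> b; apply: global_section_inj; rewrite rK.
pose gs := global_section R j.
have addA : associative (fun s t => gs (r s ⊕ r t)).
  by move=> s t u; rewrite /gs !Kr mvaddA.
have addC : commutative (fun s t => gs (r s ⊕ r t)).
  by move=> s t; rewrite mvaddC.
have add0 : left_id (gs mvzero) (fun s t => gs (r s ⊕ r t)).
  by move=> s; rewrite /gs Kr mvadd0x rK.
have negK : involutive (fun s => gs (r s)^*).
  by move=> s; rewrite /gs Kr mvnegK rK.
have add1 : left_zero (gs (r (gs mvzero))^*) (fun s t => gs (r s ⊕ r t)).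
  by move=> s; rewrite /gs !Kr mvadd1x.
have join s t : gs (r (gs (r (gs (r (gs (r s)^*) ⊕ r t)))^*) ⊕ r t) =
                gs (r (gs (r (gs (r (gs (r t)^*) ⊕ r s)))^*) ⊕ r s).
  by rewrite /gs !Kr mvjoin_sym.
exists (isMVAlgebra.Axioms_ _ _ _ addA addC add0 negK add1 join).
by split=> [//|b c|b]; rewrite -[RHS]/(gs _) !Kr.
Qed.

End Sections.
End UnitIntervalAlgebra.

(** * Chang's completeness theorem *)

Section Elimination.
Local Open Scope ring_scope.

(** A named type, so that classical equality can be attached to it; membership of constraints in
    lists relies on this. *)
Definition linear_form (V : Type) := V -> int.
HB.instance Definition _ V := gen_eqMixin (linear_form V).

(* A constraint (c, b) asks for c > 0 if b holds, and for c >= 0 otherwise. *)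
Definition constraint V := (linear_form V * bool)%type.

Definition form_eval (V : Type) (G : zmodType) (s : seq V) (x : V -> G)
  (c : linear_form V) : G := \sum_(i <- s) x i *~ c i.

(** Here [pos] stands for the elements x ≥ 0 of a total preorder, so x > 0 is expressed as the
    failure of - x ≥ 0. *)
Definition sat (G : zmodType) (pos : pred G) (b : bool) (x : G) : bool :=
  if b then ~~ pos (- x) else pos x.

Definition satisfies V (G : zmodType) (pos : pred G) (s : seq V) (x : V -> G)
  (k : constraint V) := sat pos k.2 (form_eval s x k.1).

Section Sat.
Variables (G : zmodType) (pos : pred G).
Hypothesis posD : forall x y, pos x -> pos y -> pos (x + y).
Hypothesis pos_total : forall x, pos x || pos (- x).

Lemma pos0 : pos 0.
Proof. by have := pos_total 0; rewrite oppr0 orbb. Qed.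

Lemma satW b x : sat pos b x -> pos x.
Proof. by case: b => //= h; have := pos_total x; rewrite (negbTE h) orbF. Qed.

Lemma satD b c x y : sat pos b x -> sat pos c y -> sat pos (b || c) (x + y).
Proof.
have strict u v : ~~ pos (- u) -> pos v -> ~~ pos (- (u + v)).
  move=> nu pv; apply: contra nu => h.
  by rewrite -[- u](addrNK v) -opprD; apply: posD.
case: b => [hx /satW hy|]; first exact: strict.
by case: c => [/= px hy|]; [rewrite addrC; apply: strict|exact: posD].
Qed.

Lemma satMz b x (n : int) : 0 < n -> sat pos b x -> sat pos b (x *~ n).
Proof.
case: n => // [[|n]] // _ h; rewrite -pmulrn; elim: n => [|n IH] //.
by rewrite mulrS -[b]orbb; apply: satD.
Qed.

End Sat.

Section Evaluation.
Variables (V : eqType) (G : zmodType).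
Implicit Types (s : seq V) (x : V -> G) (c d : linear_form V).

Lemma form_eval_cons v s x c :
  form_eval (v :: s) x c = x v *~ c v + form_eval s x c.
Proof. exact: big_cons. Qed.

Lemma form_evalD s x c d :
  form_eval s x (fun i => c i + d i) = form_eval s x c + form_eval s x d.
Proof. by rewrite -big_split; apply: eq_bigr => i _; rewrite mulrzDr. Qed.

Lemma form_evalB s x c d :
  form_eval s x (fun i => c i - d i) = form_eval s x c - form_eval s x d.
Proof.
by rewrite /form_eval -sumrB; apply: eq_bigr => i _; rewrite mulrzBr.
Qed.

Lemma form_evalM s x c n : form_eval s x (fun i => c i * n) = form_eval s x c *~ n.
Proof.
by rewrite /form_eval mulrz_suml; apply: eq_bigr => i _; rewrite mulrzA.
Qed.

Definition form_var (v : V) : linear_form V := fun i => (i == v)%:R.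

Lemma form_eval_var s x v : uniq s -> v \in s -> form_eval s x (form_var v) = x v.
Proof.
move=> us vs; rewrite /form_eval (bigD1_seq v) //= /form_var eqxx mulr1z.
by rewrite big1 ?addr0 // => i /negbTE ->.
Qed.

Lemma form_eval_eq s x x' c :
  {in s, x =1 x'} -> form_eval s x c = form_eval s x' c.
Proof. by move=> e; apply: eq_big_seq => i /e ->. Qed.

End Evaluation.

Lemma seq_max (R : realFieldType) (T : eqType) (f : T -> R) (s : seq T) :
  s = [::] \/ exists2 m, m \in s & {in s, forall x, f x <= f m}.
Proof.
elim: s => [|a s [->|[m ms mP]]]; first by left.
  by right; exists a; rewrite ?mem_head // => x; rewrite inE => /eqP ->.
right; have [am|ma] := leP (f a) (f m).
  by exists m; rewrite ?inE ?ms ?orbT // => x /predU1P[->//|/mP].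
exists a; rewrite ?mem_head // => x /predU1P[->//|/mP xm].
exact: le_trans xm (ltW ma).
Qed.

Section Real.
Variable R : realFieldType.

Lemma form_eval_scale (V : Type) (s : seq V) (x : V -> R) (a : R) c :
  form_eval s (fun i => x i * a) c = form_eval s x c * a.
Proof. by rewrite /form_eval mulr_suml; apply: eq_bigr => i _; rewrite mulrzAl. Qed.

Definition satR (b : bool) (x : R) := if b then 0 < x else 0 <= x.

Lemma satRE b x : satR b x = sat (fun y : R => 0 <= y) b x.
Proof. by case: b => //=; rewrite -ltNge oppr_lt0. Qed.

(** The midpoint of the largest lower bound and the least upper bound works. It meets a strict bound
    strictly, since that bound is strictly separated from the opposite extreme. *)
Lemma separating_point (T : eqType) (f : T -> R) (b : T -> bool) (Ls Us : seq T) :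
  {in Ls & Us, forall l u, satR (b l || b u) (f u - f l)} ->
  exists t, {in Ls, forall l, satR (b l) (t - f l)} /\
            {in Us, forall u, satR (b u) (f u - t)}.
Proof.
move=> LU; have [Ls0|[l lL lmax]] := seq_max f Ls;
  have [Us0|[u uU umin]] := seq_max (fun x => - f x) Us.
- by exists 0; rewrite Ls0 Us0.
- exists (f u - 1); rewrite Ls0; split=> // v /umin.
  by rewrite /satR; case: (b v); lra.
- exists (f l + 1); rewrite Us0; split=> // v /lmax.
  by rewrite /satR; case: (b v); lra.
have lu : 0 <= f u - f l.
  by have := LU _ _ lL uU; rewrite /satR; case: ifP => // _ /ltW.
exists ((f l + f u) / 2); split=> v vin.
  have := LU _ _ vin uU; have := lmax _ vin; rewrite /satR.
  case: (b v) => /=; first lra.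
  by case: (b u); lra.
have := LU _ _ lL vin; have := umin _ vin; rewrite /satR orbC.
case: (b v) => /=; first lra.
by case: (b l); lra.
Qed.

End Real.

Section Transfer.
Variables (R : realFieldType) (V : eqType) (G : zmodType) (pos : pred G).
Hypothesis posD : forall x y, pos x -> pos y -> pos (x + y).
Hypothesis pos_total : forall x, pos x || pos (- x).
Variable x : V -> G.
Local Notation posR := (fun y : R => 0 <= y).

(** The combination of p and q in which v cancels. Both multipliers are positive when v has a
    positive coefficient in p and a negative one in q. *)
Definition eliminate (v : V) (p q : constraint V) : constraint V :=
  (fun i => p.1 i * - q.1 v + q.1 i * p.1 v, p.2 || q.2).

Lemma eliminateE (H : zmodType) (z : V -> H) v s p q :
  form_eval s z (eliminate v p q).1 =
  form_eval s z p.1 *~ - q.1 v + form_eval s z q.1 *~ p.1 v.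
Proof. by rewrite form_evalD !form_evalM. Qed.

(* Fourier-Motzkin elimination, one variable of [s] at a time. *)
Theorem linear_system_transfer (s : seq V) (K : seq (constraint V)) : uniq s ->
  {in K, forall k, satisfies pos s x k} ->
  exists y : V -> R, {in K, forall k, satisfies posR s y k}.
Proof.
elim: s K => [|v s IH] K /=.
  move=> _ xK; exists (fun=> 0) => k /xK.
  rewrite /satisfies /form_eval !big_nil /sat !oppr0 pos0 // lexx.
  by case: k.2.
case/andP=> vs us xK.
(* Constraints in P bound v from below, those in N from above, and those in Z do not involve it. *)
pose P := [seq k <- K | 0 < k.1 v]; pose N := [seq k <- K | k.1 v < 0].
pose Z := [seq k <- K | k.1 v == 0].
have [k|y yK] := IH (Z ++ [seq eliminate v p q | p <- P, q <- N]) us.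
  rewrite mem_cat => /orP[|/allpairsP[[p q] [/=]]].
    rewrite mem_filter => /andP[/eqP k0 /xK].
    by rewrite /satisfies form_eval_cons k0 mulr0z add0r.
  rewrite !mem_filter => /andP[p0 /xK xp] /andP[q0 /xK xq] ->.
  (* The coefficient of v is now 0, so v may be put back among the variables. *)
  have -> : satisfies pos s x (eliminate v p q) =
            satisfies pos (v :: s) x (eliminate v p q).
    by rewrite /satisfies form_eval_cons /= mulrN mulrC addNr mulr0z add0r.
  rewrite /satisfies eliminateE; apply: satD => //.
    by apply: satMz => //; rewrite oppr_gt0.
  exact: satMz.
(* The value of v at which k becomes an equality, the other variables being given by y. *)
pose r (k : constraint V) : R := - form_eval s y k.1 / (k.1 v)%:~R.
have [|t [tP tN]] := @separating_point R _ r snd P N.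
  move=> p q pP qN.
  have : satisfies posR s y (eliminate v p q).
    by apply: yK; rewrite mem_cat; apply/orP; right; apply/allpairsP; exists (p, q).
  move: pP qN; rewrite !mem_filter => /andP[p0 _] /andP[q0 _].
  rewrite /satisfies eliminateE -satRE.
  rewrite -[X in X + _]mulrzr -[X in _ + X]mulrzr [_.2]/= => h.
  have p0' : 0 < (p.1 v)%:~R :> R by rewrite ltr0z.
  have q0' : 0 < - (q.1 v)%:~R :> R by rewrite oppr_gt0 ltrz0.
  (* The gap between the two bounds is the eliminated form divided by a positive number. *)
  have e : r q - r p =
      (form_eval s y p.1 * (- q.1 v)%:~R + form_eval s y q.1 * (p.1 v)%:~R) /
      ((p.1 v)%:~R * - (q.1 v)%:~R).
    have a0 := lt0r_neq0 p0'; have := lt0r_neq0 q0'; rewrite oppr_eq0 => b0.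
    by rewrite /r mulrNz; field; rewrite a0 b0.
  rewrite e; have d0 := mulr_gt0 p0' q0'; move: h; rewrite /satR.
  case: (p.2 || q.2) => h.
    by rewrite divr_gt0.
  by rewrite divr_ge0 // ltW.
exists (fun i => if i == v then t else y i) => k kK.
rewrite /satisfies form_eval_cons eqxx.
rewrite (@form_eval_eq _ _ s _ y); last first.
  by move=> i si; case: eqP => // iv; rewrite -iv si in vs.
rewrite -satRE -[X in X + _]mulrzr; have [k0|k0|k0] := ltgtP (k.1 v) 0.
- have : k \in N by rewrite mem_filter k0.
  move=> /tN; rewrite /r => h.
  have k0' : (k.1 v)%:~R < 0 :> R by rewrite ltrz0.
  have e : t * (k.1 v)%:~R + form_eval s y k.1 =
     (- form_eval s y k.1 / (k.1 v)%:~R - t) * - (k.1 v)%:~R.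
    by field; rewrite lt_eqF.
  rewrite e; move: h; rewrite /satR; case: k.2 => h.
    by rewrite mulr_gt0 // oppr_gt0.
  by rewrite mulr_ge0 // oppr_ge0 ltW.
- have : k \in P by rewrite mem_filter k0.
  move=> /tP; rewrite /r => h.
  have k0' : 0 < (k.1 v)%:~R :> R by rewrite ltr0z.
  have e : t * (k.1 v)%:~R + form_eval s y k.1 =
     (t - - form_eval s y k.1 / (k.1 v)%:~R) * (k.1 v)%:~R.
    by field; rewrite gt_eqF.
  rewrite e; move: h; rewrite /satR; case: k.2 => h.
    by rewrite mulr_gt0.
  by rewrite mulr_ge0 // ltW.
- have : satisfies posR s y k by apply: yK; rewrite mem_cat mem_filter k0 eqxx kK.
  by rewrite /satisfies -satRE k0 mulr0 add0r.
Qed.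

End Transfer.
End Elimination.

(** * Exchange laws between ⊕ and ⊙, for addition with carry *)

Section AddMul.
Variable B : mvType.
Implicit Types a b c : B.

(** Read in an ordered group with unit u, the hypotheses are a + b ≥ u and b + c ≤ u, and both sides
    are a + b + c - u. The proof splits b as a^* ⊕ (a ⊙ b) and cancels a^*. *)
Lemma mvmul_add_chain a b c : a ⊕ b = mvone -> b ⊙ c = mvzero ->
  a ⊙ (b ⊕ c) = (a ⊙ b) ⊕ c.
Proof.
move=> /eqP; rewrite mvadd_eq1 => ab /eqP; rewrite mvmulC mvmul_eq0 => cb.
have bE : b = a^* ⊕ (a ⊙ b).
  by rewrite -{1}(mvle_join ab) mvjoinC /mvjoin /mvsub mvnegK mvaddC [b ⊙ a]mvmulC.
rewrite {1}bE -mvaddA [a^* ⊕ _]mvaddC -{1}[a]mvnegK [_^*^* ⊙ _]mvmulC.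
rewrite -/(mvsub _ _) mvaddK //; apply/eqP; rewrite mvmul_eq0 mvnegK.
apply: mvle_trans (mvle_add2 (mvle_refl _) cb) _.
rewrite -[a ⊙ b](_ : a ⊖ b^* = _); last by rewrite /mvsub mvnegK.
rewrite -/(mvjoin _ _) mvjoin_lub mvle_refl /=.
by rewrite -mvleN mvnegK.
Qed.

(** Here a + b ≤ u and b + c ≤ u, and both sides are a + b + c - u cut off at 0. The proof splits
    a^* as b ⊕ (a^* ⊖ b) and cancels b. *)
Lemma mvmul_addA a b c : a ⊙ b = mvzero -> b ⊙ c = mvzero ->
  a ⊙ (b ⊕ c) = (a ⊕ b) ⊙ c.
Proof.
move=> /eqP; rewrite mvmulC mvmul_eq0 => ba bc.
have aE : a^* = b ⊕ (a^* ⊖ b) by rewrite mvaddC -/(mvjoin _ _) mvjoinC mvle_join.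
rewrite -{1}[a]mvnegK {1}aE mvnegD [LHS]mvmulC mvmulA -/(mvsub _ b) [b ⊕ c]mvaddC.
rewrite mvaddK; last by rewrite mvmulC.
by rewrite mvmulC /mvsub mvnegM !mvnegK.
Qed.

Hypothesis tot : forall x y : B, mvle x y || mvle y x.

Lemma mvtotal_add_mul a b : a ⊕ b = mvone \/ a ⊙ b = mvzero.
Proof.
by have /orP[h|h] := tot a^* b; [left|right]; apply/eqP;
  rewrite ?mvadd_eq1 // mvmulC mvmul_eq0.
Qed.

Lemma mvmul_add_left_comm a b c : a ⊙ c = mvzero -> b ⊙ c = mvzero ->
  a ⊙ (b ⊕ c) = b ⊙ (a ⊕ c).
Proof.
move=> ac bc; have [ab|ab] := mvtotal_add_mul a b.
  have ba : b ⊕ a = mvone by rewrite mvaddC.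
  by rewrite (mvmul_add_chain ab bc) (mvmul_add_chain ba ac) mvmulC.
have ba : b ⊙ a = mvzero by rewrite mvmulC.
by rewrite (mvmul_addA ab bc) (mvmul_addA ba ac) [b ⊕ a]mvaddC.
Qed.

(** The dual of [mvmul_add_left_comm] under negation. *)
Lemma mvadd_mul_left_comm a b c : a ⊕ c = mvone -> b ⊕ c = mvone ->
  a ⊕ (b ⊙ c) = b ⊕ (a ⊙ c).
Proof.
move=> ac bc; apply: (can_inj (@mvnegK B)); rewrite !mvnegD !mvnegM.
by rewrite (@mvmul_add_left_comm a^*) // -mvnegD ?ac ?bc mvnegone.
Qed.

End AddMul.

(** * Terms, and their linearisation over a chain *)

Inductive mvterm (V : Type) : Type :=
  | TVar of V
  | TZero
  | TAdd of mvterm V & mvterm V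
  | TNeg of mvterm V.
Arguments TZero {V}.

Fixpoint teval (V : Type) (B : mvType) (x : V -> B) (t : mvterm V) : B :=
  match t with
  | TVar a => x a
  | TZero => mvzero
  | TAdd t1 t2 => teval x t1 ⊕ teval x t2
  | TNeg t1 => (teval x t1)^*
  end.

Fixpoint tvars (V : Type) (t : mvterm V) : seq V :=
  match t with
  | TVar a => [:: a]
  | TZero => [::]
  | TAdd t1 t2 => tvars t1 ++ tvars t2
  | TNeg t1 => tvars t1
  end.

(* Chang's totally ordered group of an MV-chain: the pair (n, a) stands for
   n u + a with 0 <= a < u, where u is the strong unit. *)
Section ChangGroup.
Variable C : mvType.
Hypothesis tot : forall x y : C, mvle x y || mvle y x.
Hypothesis nontrivial : (mvzero : C) != mvone.

(** A carry occurs when a + b reaches u; [remain] is the sum modulo u, since a ⊙ b is then a + b -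
    u. *)
Definition carry (a b : C) : bool := a ⊕ b == mvone.
Definition remain (a b : C) : C := if carry a b then a ⊙ b else a ⊕ b.

Lemma carryC a b : carry a b = carry b a.
Proof. by rewrite /carry mvaddC. Qed.

Lemma remainC a b : remain a b = remain b a.
Proof. by rewrite /remain carryC mvmulC mvaddC. Qed.

Lemma carryN a b : ~~ carry a b -> a ⊙ b = mvzero.
Proof.
by rewrite /carry; case: (mvtotal_add_mul tot a b) => [->|//]; rewrite eqxx.
Qed.

Lemma mvmul_neq1 (a b : C) : a != mvone -> a ⊙ b != mvone.
Proof.
move=> a1; apply: contra a1 => /eqP h.
by apply/eqP/mv1le; have := mvle_mull a b; rewrite h.
Qed.

Lemma remain_neq1 (a b : C) : a != mvone -> remain a b != mvone.
Proof.
by move=> a1; rewrite /remain; case: ifP => [_|/negbT//]; exact: mvmul_neq1.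
Qed.

(** Together with commutativity this gives associativity of addition with carry. The symmetry in a
    and b leaves one mixed case instead of two. *)
Lemma remain_left_comm (a b c : C) : a != mvone -> b != mvone -> c != mvone ->
  remain a (remain b c) = remain b (remain a c) /\
  (carry b c + carry a (remain b c) = carry a c + carry b (remain a c))%N.
Proof.
wlog: a b / carry a c -> carry b c => [wl a1 b1 c1|ac_bc a1 b1 c1].
  have /orP[bc|nbc] := orbN (carry b c); first by apply: wl.
  have [|//|//|//|e1 e2] := wl b a; first by rewrite (negbTE nbc).
  by rewrite e1 e2.
have /orP[bc|bc] := orbN (carry b c); have /orP[ac|ac] := orbN (carry a c).
- have e : a ⊕ (b ⊙ c) = b ⊕ (a ⊙ c).
    by apply: (mvadd_mul_left_comm tot); apply/eqP.
  rewrite /remain bc ac /carry e; case: ifP => // _.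
  by rewrite !mvmulA [a ⊙ b]mvmulC.
(* The single carry occurs in the inner addition on one side and in the outer one on the other. *)
- have e : b ⊙ (c ⊕ a) = (b ⊙ c) ⊕ a.
    by apply: mvmul_add_chain; [exact/eqP|rewrite mvmulC carryN].
  have c1' : carry b (a ⊕ c).
    by rewrite /carry [a ⊕ c]mvaddC mvaddA (eqP bc) mvaddC mvaddx1.
  have c2 : carry a (b ⊙ c) = false.
    by apply/negbTE; rewrite /carry mvaddC -e mvmul_neq1.
  by rewrite /remain bc (negbTE ac) c1' c2 [a ⊕ c]mvaddC e mvaddC.
- by have := ac_bc ac; rewrite (negbTE bc).
- have e : a ⊕ (b ⊕ c) = b ⊕ (a ⊕ c) by rewrite mvaddA [a ⊕ b]mvaddC -mvaddA.
  rewrite /remain (negbTE bc) (negbTE ac) /carry e; case: ifP => // _.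
  by rewrite (mvmul_add_left_comm tot) // carryN.
Qed.

Definition chang_group := (int * {a : C | a != mvone})%type.
HB.instance Definition _ := Choice.on chang_group.

Local Open Scope ring_scope.
Local Open Scope mv_scope.

Definition chang_mk (n : int) (a : C) (h : a != mvone) : chang_group :=
  (n, exist _ a h).

Lemma chang_eq (x y : chang_group) : x.1 = y.1 -> val x.2 = val y.2 -> x = y.
Proof. by case: x y => [m a] [n b] /= -> e; congr pair; apply: val_inj. Qed.

Definition chang_add (x y : chang_group) : chang_group :=
  chang_mk (x.1 + y.1 + (carry (val x.2) (val y.2))%:R)
    (remain_neq1 (val y.2) (valP x.2)).

Definition chang_zero : chang_group := chang_mk 0 nontrivial.

(* [insubd] turns 0^* = 1, which is not a remainder, into 0. *)
Definition chang_opp (x : chang_group) : chang_group :=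
  (- x.1 - (val x.2 != mvzero)%:R, insubd chang_zero.2 (val x.2)^*).

Fact chang_addC : commutative chang_add.
Proof.
by move=> x y; apply: chang_eq => /=; rewrite 1?remainC // carryC [x.1 + _]addrC.
Qed.

Fact chang_add_left_comm x y z :
  chang_add x (chang_add y z) = chang_add y (chang_add x z).
Proof.
have [h1 h2] := remain_left_comm (valP x.2) (valP y.2) (valP z.2).
apply: chang_eq => //=; move/(congr1 (fun n : nat => n%:R : int)): h2.
rewrite !natrD => h2; rewrite -[LHS]addrA -[X in _ + X = _]addrA h2.
by rewrite !addrA [x.1 + y.1]addrC.
Qed.

Fact chang_addA : associative chang_add.
Proof.
move=> x y z; rewrite [chang_add y z]chang_addC chang_add_left_comm.
by rewrite [RHS]chang_addC.
Qed.

Fact chang_add0 : left_id chang_zero chang_add.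
Proof.
move=> x; have e : carry mvzero (val x.2) = false.
  by rewrite /carry mvadd0x; apply/negbTE/(valP x.2).
by apply: chang_eq; rewrite /= /remain e ?mvadd0x // add0r addr0.
Qed.

Fact chang_addN : left_inverse chang_zero chang_opp chang_add.
Proof.
move=> [n [a a1]]; have a'E : (a^* != mvone) = (a != mvzero).
  by rewrite -[mvone]/(mvzero^*) (can_eq (@mvnegK C)).
rewrite /chang_opp /=; have := val_insubd chang_zero.2 a^*; rewrite a'E.
move: (insubd _ _) => u uE; apply: chang_eq; rewrite /= /remain /carry [sval u]uE;
  have [->|a0] /= := eqVneq a mvzero.
- by rewrite mvadd0x (negbTE nontrivial) subr0 addr0 addNr.
- by rewrite mvaddC mvaddxN eqxx /= addrAC addrNK addNr.
- by rewrite mvadd0x (negbTE nontrivial).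
- by rewrite mvaddC mvaddxN eqxx mvmulC mvmulxN.
Qed.

HB.instance Definition _ := GRing.isZmodule.Build chang_group
  chang_addA chang_addC chang_add0 chang_addN.

(** As 0 ≤ a < u, the sign of n u + a is decided by n. *)
Definition chang_pos (x : chang_group) : bool := 0 <= x.1.

Lemma chang_posD x y : chang_pos x -> chang_pos y -> chang_pos (x + y)%R.
Proof. by move=> x0 y0; rewrite /chang_pos /= !addr_ge0 // ler0n. Qed.

Lemma chang_oppE (x : chang_group) : (- x)%R.1 = - x.1 - (val x.2 != mvzero)%:R.
Proof. by []. Qed.

Lemma chang_addE1 (x y : chang_group) :
  (x + y)%R.1 = x.1 + y.1 + (carry (val x.2) (val y.2))%:R.
Proof. by []. Qed.

Lemma chang_addE2 (x y : chang_group) :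
  val (x + y)%R.2 = remain (val x.2) (val y.2).
Proof. by []. Qed.

Lemma chang_pos_total x : chang_pos x || chang_pos (- x)%R.
Proof. by rewrite /chang_pos chang_oppE; case: (val x.2 != mvzero) => /=; lia. Qed.

Definition chang_unit : chang_group := chang_mk 1 nontrivial.

(** The top element is not a remainder; it goes to (1, 0), the strong unit, through the default of
    [insubd]. *)
Definition chang_embed (a : C) : chang_group :=
  ((a == mvone)%:R, insubd chang_zero.2 a).

Lemma chang_embedE2 a : val (chang_embed a).2 = if a == mvone then mvzero else a.
Proof. by rewrite val_insubd; case: eqP. Qed.

Lemma chang_embed0 : chang_embed mvzero = 0%R.
Proof. by apply: chang_eq; rewrite ?chang_embedE2 /= (negbTE nontrivial). Qed.

Lemma chang_embed1 : chang_embed mvone = chang_unit.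
Proof. by apply: chang_eq; rewrite ?chang_embedE2 /= eqxx. Qed.

Lemma chang_embedE1 a : (chang_embed a).1 = (a == mvone)%:R.
Proof. by []. Qed.

Lemma chang_embed_pos a : chang_pos (chang_embed a).
Proof. by rewrite /chang_pos /= ler0n. Qed.

(** For a other than 0 and 1, adding a and a^* produces one carry and the remainder a ⊙ a^* = 0. *)
Lemma chang_embedN a : chang_embed a^* = (chang_unit - chang_embed a)%R.
Proof.
apply: (addIr (chang_embed a)); rewrite subrK.
have [->|a0] := eqVneq a mvzero; first by rewrite chang_embed0 addr0 chang_embed1.
have [->|a1] := eqVneq a mvone.
  by rewrite mvnegone chang_embed0 add0r chang_embed1.
have a'1 : (a^* == mvone) = false.
  by apply: contra_neqF a0 => /eqP h; rewrite -[a]mvnegK h mvnegone.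
apply: chang_eq; rewrite ?chang_addE1 ?chang_addE2 ?chang_embedE1 !chang_embedE2;
  by rewrite /remain /carry (negbTE a1) a'1 mvaddC mvaddxN eqxx // mvmulC mvmulxN.
Qed.

(** This is a ⊕ b = min(u, a + b), with the inequality that certifies which of the two is taken. *)
Lemma chang_embedD a b :
  chang_embed (a ⊕ b) = (chang_embed a + chang_embed b)%R /\
    chang_pos (chang_unit - (chang_embed a + chang_embed b))%R \/
  chang_embed (a ⊕ b) = chang_unit /\
    chang_pos ((chang_embed a + chang_embed b) - chang_unit)%R.
Proof.
have [->|a1] := eqVneq a mvone.
  right; rewrite mvaddC mvaddx1 chang_embed1; split=> //.
  by rewrite addrC addKr chang_embed_pos.
have [->|b1] := eqVneq b mvone.
  by right; rewrite mvaddx1 chang_embed1 addrK chang_embed_pos.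
have [/eqP ab|ab] := boolP (carry a b).
  right; rewrite ab chang_embed1; split=> //.
  rewrite /chang_pos chang_addE1 chang_oppE chang_addE1 !chang_embedE1.
  rewrite !chang_embedE2 (negbTE a1) (negbTE b1) /carry ab eqxx /= eqxx.
  by case: (_ == _).
have e : chang_embed (a ⊕ b) = (chang_embed a + chang_embed b)%R.
  apply: chang_eq; rewrite ?chang_addE1 ?chang_addE2 ?chang_embedE1 !chang_embedE2;
    by rewrite (negbTE a1) (negbTE b1) /remain -/(carry a b) (negbTE ab).
by left; rewrite -e -chang_embedN chang_embed_pos.
Qed.

Lemma chang_embed_eq0 a : chang_pos (- chang_embed a)%R -> a = mvzero.
Proof.
rewrite /chang_pos chang_oppE chang_embedE1 chang_embedE2.
have [->|a1] := eqVneq a mvone; first by rewrite eqxx.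
by have [//|a0] := eqVneq a mvzero.
Qed.

Lemma chang_unit_pos : ~~ chang_pos (- chang_unit)%R.
Proof. by rewrite /chang_pos chang_oppE /= eqxx. Qed.

Variables (R : realType) (V : eqType) (v : V -> C).
Local Notation posR := (fun r : R => 0 <= r).

Definition chang_val (o : option V) : chang_group :=
  if o is Some a then chang_embed (v a) else chang_unit.

Definition real_val (y : V -> I01 R) (o : option V) : R :=
  if o is Some a then val (y a) else 1.

(* Each truncated sum occurring in [t] is resolved as it is at [v]; on the
   region where it stays so, [t] is given by an integral linear form [L] in the
   variables and the strong unit [None]. *)
Lemma term_trace (t : mvterm V) (s : seq (option V)) :
  uniq s -> None \in s -> {in tvars t, forall a, Some a \in s} ->
  exists (L : linear_form (option V)) (K : seq (constraint (option V))),
  [/\ form_eval s chang_val L = chang_embed (teval v t),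
      {in K, forall k, satisfies (@chang_pos) s chang_val k}
    & forall y, {in K, forall k, satisfies posR s (real_val y) k} ->
        val (teval y t) = form_eval s (real_val y) L].
Proof.
move=> us sN; elim: t => [a|| t1 IH1 t2 IH2|t IH] st.
- exists (form_var (Some a)), [::]; split=> [|//|y _];
    by rewrite form_eval_var // st ?mem_head.
- exists (fun=> 0), [::]; split=> [|//|y _].
    by rewrite chang_embed0 /form_eval big1.
  by rewrite /form_eval big1.
- have [|L1 [K1 [E1 S1 R1]]] := IH1; first by move=> a h; rewrite st //= mem_cat h.
  have [|L2 [K2 [E2 S2 R2]]] := IH2.
    by move=> a h; rewrite st //= mem_cat h orbT.
  (* The inequality of the case that holds at [v] joins the constraints; over the reals it forces
     the minimum to be taken on the same side. *)
  have [[eD pD]|[eD pD]] := chang_embedD (teval v t1) (teval v t2).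
    exists (fun i => L1 i + L2 i),
      ((fun i => form_var None i - (L1 i + L2 i), false) :: K1 ++ K2).
    split=> [|k|y yK]; first by rewrite form_evalD E1 E2 -eD.
      rewrite inE mem_cat => /or3P[/eqP->|/S1//|/S2//].
      by rewrite /satisfies /= form_evalB form_evalD form_eval_var // E1 E2.
    have := yK _ (mem_head _ _).
    rewrite /satisfies -satRE form_evalB form_eval_var // /satR.
    rewrite form_evalD -[teval y _]/(teval y t1 ⊕ teval y t2) val_i01D.
    rewrite R1 ?R2; last 2 first.
    + by move=> k h; apply: yK; rewrite inE mem_cat h !orbT.
    + by move=> k h; apply: yK; rewrite inE mem_cat h !orbT.
    by rewrite subr_ge0 => /min_idPr.
  exists (form_var None),
    ((fun i => (L1 i + L2 i) - form_var None i, false) :: K1 ++ K2).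
  split=> [|k|y yK]; first by rewrite form_eval_var // -eD.
    rewrite inE mem_cat => /or3P[/eqP->|/S1//|/S2//].
    by rewrite /satisfies /= form_evalB form_evalD form_eval_var // E1 E2.
  have := yK _ (mem_head _ _).
  rewrite /satisfies -satRE form_evalB form_eval_var // /satR.
  rewrite form_evalD -[teval y _]/(teval y t1 ⊕ teval y t2) val_i01D.
  rewrite R1 ?R2; last 2 first.
  + by move=> k h; apply: yK; rewrite inE mem_cat h !orbT.
  + by move=> k h; apply: yK; rewrite inE mem_cat h !orbT.
  by rewrite subr_ge0 => /min_idPl.
- have [L [K [EL SL RL]]] := IH st; exists (fun i => form_var None i - L i), K.
  split=> // [|y yK]; rewrite form_evalB form_eval_var //.
    by rewrite EL -chang_embedN.
  by rewrite -[teval y _]/((teval y t)^*) val_i01N (RL y).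
Qed.

(** The system makes the unit and the form L of t strictly positive, keeps each variable between 0
    and the unit, and includes the trace of t. It is solved in Chang's group, hence in the reals. *)
Theorem chain_completeness (t : mvterm V) : teval v t <> mvzero ->
  exists y : V -> I01 R, teval y t <> mvzero.
Proof.
move=> vt; pose s := None :: map Some (undup (tvars t)).
have us : uniq s.
  rewrite /= map_inj_uniq ?undup_uniq ?andbT; last by move=> a b [].
  by apply/mapP => -[].
have sN : None \in s by rewrite mem_head.
have sS : {in tvars t, forall a, Some a \in s}.
  by move=> a h; rewrite inE /= map_f // mem_undup.
have [L [K [EL SL RL]]] := term_trace us sN sS.
pose bounds := [seq (form_var (Some a) : linear_form _, false) | a <- tvars t] ++
  [seq ((fun i => form_var None i - form_var (Some a) i) : linear_form _, false)
     | a <- tvars t].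
have [k|z zK] := @linear_system_transfer R _ _ (@chang_pos) chang_posD
    chang_pos_total chang_val s
    ((form_var None, true) :: (L, true) :: bounds ++ K) us.
  rewrite !inE !mem_cat => /or4P[/eqP->|/eqP->|/orP[]/mapP[a ta ->]|/SL//].
  - by rewrite /satisfies form_eval_var //= chang_unit_pos.
  - by rewrite /satisfies EL /=; apply/negP => /chang_embed_eq0.
  - by rewrite /satisfies form_eval_var ?sS //= chang_embed_pos.
  - rewrite /satisfies form_evalB !form_eval_var ?sS //= -chang_embedN.
    exact: chang_embed_pos.
have zB k : k \in bounds -> satisfies posR s z k.
  by move=> kb; apply: zK; rewrite !inE mem_cat kb !orbT.
pose u := z None.
have u0 : 0 < u.
  have := zK (form_var None, true); rewrite mem_head => /(_ isT).
  by rewrite /satisfies form_eval_var // -satRE.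
(* Division by the value u of the strong unit normalises it to 1. Letters that do not occur in t
   receive 0. *)
have /choice[y yE] a : exists r : I01 R, a \in tvars t -> val r = z (Some a) / u.
  have [ta|_] := boolP (a \in tvars t); last by exists mvzero.
  have h : 0 <= z (Some a) / u <= 1.
    rewrite ler_pdivrMr // mul1r divr_ge0 ?(ltW u0) //=.
      have := zB (fun i => form_var None i - form_var (Some a) i, false).
      rewrite mem_cat; set b := (X in _ || X); have -> : b by apply/mapP; exists a.
      rewrite orbT => /(_ isT).
      by rewrite /satisfies form_evalB !form_eval_var ?sS //= subr_ge0.
    have := zB (form_var (Some a), false).
    rewrite mem_cat; set b := (X in X || _); have -> : b by apply/mapP; exists a.
    move=> /(_ isT).
    by rewrite /satisfies form_eval_var ?sS.
  by exists (mk01 h).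
have yz c : form_eval s (real_val y) c = form_eval s z c / u.
  rewrite -form_eval_scale; apply: form_eval_eq => -[a|]; last first.
    by rewrite divff // gt_eqF.
  by rewrite inE /= mem_map => [|? ? []//]; rewrite mem_undup => /yE.
exists y => /(congr1 val); rewrite RL => [|k kK].
  rewrite yz val_i010 => e0; have := zK (L, true).
  rewrite !inE eqxx orbT => /(_ isT); rewrite /satisfies -satRE /=.
  by rewrite -(pmulr_lgt0 _ (_ : 0 < u^-1)) ?invr_gt0 // e0 ltxx.
have := zK k; rewrite !inE mem_cat kK !orbT => /(_ isT).
rewrite /satisfies yz -!satRE /satR; case: k.2 => h; first exact: divr_gt0.
by rewrite divr_ge0 // ltW.
Qed.

End ChangGroup.

Lemma teval_morphism (V : Type) (B C : mvType) (f : B -> C) (x : V -> B) t :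
  mv_morphism f -> teval (f \o x) t = f (teval x t).
Proof.
move=> [f0 fD fN]; elim: t => //= [t1 -> t2 ->|t ->]; first by rewrite fD.
by rewrite fN.
Qed.

(** A nonzero value of t is missed by some prime P, so it stays nonzero in the chain A/P. *)
Lemma completeness (R : realType) (A : mvType) (V : eqType) (v : V -> A)
  (t : mvterm V) :
  (forall y : V -> I01 R, teval y t = mvzero) -> teval v t = mvzero.
Proof.
move=> yt; apply: contrapT => /prime_avoiding[P [pP Pt]]; have [iP nT _] := pP.
pose I := MVIdeal iP.
have tot (x y : quo I) : mvle x y || mvle y x by exact: quo_prime_total.
have nontrivial : (mvzero : quo I) != mvone.
  apply/eqP => e; have : mvone = mvzero :> quo I by [].
  rewrite -(mvmorph1 (cls_morphism I)) => /cls0P.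
  by move: nT => /(ideal_properP iP).
have [|y] := @chain_completeness _ tot nontrivial R V (cls I \o v) t.
  by rewrite (teval_morphism _ _ (cls_morphism I)) => /cls0P.
by apply; apply: yt.
Qed.

(** * The extension of A by the unit interval *)

Section Power.
Variables (X : Type) (B : mvType).

Definition mvpower := X -> B.
HB.instance Definition _ := gen_eqMixin mvpower.
HB.instance Definition _ := gen_choiceMixin mvpower.

Implicit Types f g : mvpower.

Definition power_zero : mvpower := fun=> mvzero.
Definition power_add f g : mvpower := fun x => f x ⊕ g x.
Definition power_neg f : mvpower := fun x => (f x)^*.

Fact power_addA : associative power_add.
Proof. by move=> f g h; apply: funext => x; apply: mvaddA. Qed.
Fact power_addC : commutative power_add.
Proof. by move=> f g; apply: funext => x; apply: mvaddC. Qed.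
Fact power_add0 : left_id power_zero power_add.
Proof. by move=> f; apply: funext => x; apply: mvadd0x. Qed.
Fact power_negK : involutive power_neg.
Proof. by move=> f; apply: funext => x; apply: mvnegK. Qed.
Fact power_add1 : left_zero (power_neg power_zero) power_add.
Proof. by move=> f; apply: funext => x; apply: mvadd1x. Qed.
Fact power_join_sym f g :
  power_add (power_neg (power_add (power_neg f) g)) g =
  power_add (power_neg (power_add (power_neg g) f)) f.
Proof. by apply: funext => x; apply: mvjoin_sym. Qed.

HB.instance Definition _ := isMVAlgebra.Build mvpower
  power_addA power_addC power_add0 power_negK power_add1 power_join_sym.

Lemma power_leP f g : mvle f g <-> forall x, mvle (f x) (g x).
Proof.
split=> [/eqP e x|fg]; first by apply/eqP; have := congr1 (fun h => h x) e.
by apply/eqP/funext => x; apply/eqP/fg.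
Qed.

End Power.

(* A is the quotient of the algebra of term functions on [0,1]^A by the terms
   vanishing in A; dividing all of [0,1]^([0,1]^A) by the ideal these generate
   adds the constants of [0,1]. *)
Section Extension.
Variables (R : realType) (A : mvType).
Local Notation FA := (mvpower (A -> I01 R) (I01 R)).
Local Notation value t := (teval (@id A) t).

Definition term_fun (t : mvterm A) : FA := fun y => teval y t.

Definition TSub V (s t : mvterm V) := TNeg (TAdd (TNeg s) (TNeg (TNeg t))).

Lemma tevalB V (B : mvType) (x : V -> B) s t :
  teval x (TSub s t) = teval x s ⊖ teval x t.
Proof. by []. Qed.

(** The vanishing terms are closed under ⊕, so the downward closure of their functions is already
    the ideal they generate. *)
Fact relations_subproof :
  is_ideal [set f : FA | exists t, value t = mvzero /\ mvle f (term_fun t)].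
Proof.
split.
- by exists TZero; rewrite mv0le.
- move=> f g [s [s0 fs]] [t [t0 gt]]; exists (TAdd s t); split.
    by rewrite /= s0 t0 mvadd0x.
  exact: mvle_add2 fs gt.
- by move=> f g fg [t [t0 gt]]; exists t; split=> //; apply: mvle_trans fg gt.
Qed.
Definition relations : mvideal FA := MVIdeal relations_subproof.

(** If s ⊖ t lies pointwise below a term r that vanishes in A, then (s ⊖ t) ⊖ r vanishes on [0,1],
    hence in A by completeness; this gives s ≤ t in A. *)
Lemma term_cls_eq s t :
  cls relations (term_fun s) = cls relations (term_fun t) <-> value s = value t.
Proof.
split=> [|st]; last first.
  by apply/clsP; split; [exists (TSub s t)|exists (TSub t s)];
    rewrite tevalB st mvsubxx; split=> //; apply: mvle_refl.
have le s' t' : relations (term_fun s' ⊖ term_fun t') -> mvle (value s') (value t').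
  move=> [r [r0 /power_leP str]].
  have := @completeness R A A id (TSub (TSub s' t') r) (fun y => eqP (str y)).
  by rewrite !tevalB r0 mvsubx0 => /eqP.
by move=> /clsP[/le st /le ts]; apply: mvle_anti.
Qed.

(** Reals go to constant functions, and an element a of A goes to the class of the variable a. The
    latter is a morphism because terms of equal value in A have equal classes. *)
Lemma embeds_in_unit_algebra : exists (B : mvType) (e : I01 R -> B) (h : A -> B),
  mv_morphism e /\ mv_embedding h.
Proof.
exists (quo relations), (fun r => cls relations (fun=> r)),
  (fun a => cls relations (term_fun (TVar a))).
split; first by split=> *; rewrite -?clsD -?clsN.
split; last by move=> a b /term_cls_eq.
split=> [|a b|a].
- exact: (proj2 (term_cls_eq _ TZero)).
- by rewrite -clsD; apply: (proj2 (term_cls_eq _ (TAdd (TVar a) (TVar b)))).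
- by rewrite -clsN; apply: (proj2 (term_cls_eq _ (TNeg (TVar a)))).
Qed.

End Extension.

Theorem corollary7p7 (R : realType) (A : mvType) :
  exists B : mvType,
    locally_retractive B /\
    forall j : retractions B,
      exists m : isMVAlgebra.axioms_ (sections R j),
        is_section_algebra m /\
        exists h : A -> with_mv m, mv_embedding h.
Proof.
have [B [e [h [eM [hM h_inj]]]]] := embeds_in_unit_algebra R A.
exists B; split; first exact: locally_retractive_unit eM.
move=> j; have [m mS] := section_algebra_exists j eM.
exists m; split=> //; exists (global_section R j \o h : A -> with_mv m); split.
  exact: (@comp_morphism A B (with_mv m)).
by move=> a b /(global_section_inj eM)/h_inj.
Qed.
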